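(* Let $d\ge3$. There exists a constant $C>0$ depending only on $d$ such that for every isotropic unimodal Lévy process $X=(X_t)$ in $\mathbb{R}^d$ with characteristic exponent $\psi\not\equiv0$ and every $r\ge0$, $$C^{-1}\psi^*(r^{-1})\,r^d\le\mathrm{Cap}\left(\overline{B_r}\right)\le C\,\psi^*(r^{-1})\,r^d,$$ where for $r=0$ we set $\overline{B_0}=\{0\}$ and $\psi^*(r^{-1})r^d=0$.
   Context: The characteristic exponent is defined by $E^0e^{i\langle\xi,X_t\rangle}=e^{-t\psi(\xi)}$. A measure $m$ on $\mathbb{R}^d$ is isotropic unimodal if there is a non-increasing $m_0:(0,\infty)\to[0,\infty)$ with $m(dx)=m_0(|x|)dx$ on $\mathbb{R}^d\setminus\{0\}$ (an atom at $0$ is allowed); $X$ is isotropic unimodal if $P^0(X_t\in dx)$ is isotropic unimodal for every $t>0$ (then $\psi$ is real and radial). $\psi^*(u)=\sup_{|x|\le u}\psi(x)$. $B_r=B(0,r)$ is the open ball, $\overline{B_r}$ its closure. For $d\ge3$ the process is transient, with potential measure $G(A)=E^0\int_0^\infty\mathbf 1_A(X_t)dt$. $\mathrm{Cap}$ denotes the ($0$-)capacity of $X$: for a non-empty compact set $A$ there is a measure $\rho_A$ supported by $A$ (the equilibrium measure) with $\int G(F-x)\rho_A(dx)=\int_FP^x(T_A<\infty)dx$ for all Borel $F$, where $T_A=\inf\{t>0:X_t\in A\}$, and $\mathrm{Cap}(A)=\rho_A(A)$. *)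

(* Defs.v *)
From HB Require Import structures.
From mathcomp Require Import all_boot all_order all_algebra.
From mathcomp Require Import all_classical all_reals all_analysis.
From mathcomp Require Import complex.

Set Implicit Arguments.
Unset Strict Implicit.
Unset Printing Implicit Defensive.

Import Order.TTheory GRing.Theory Num.Theory.
Import numFieldNormedType.Exports.

Local Open Scope classical_set_scope.
Local Open Scope ring_scope.

Definition measure_rV_display : measure_display -> measure_display.
Proof. exact. Qed.

(* 'rV[T]_n carries the product sigma-algebra, like n.-tuple T; for T = R this
   is the Borel sigma-algebra of R^n. *)
Section measurable_rV.
Context {d} {T : measurableType d}.
Variable n : nat.

Let coord : 'I_n -> 'rV[T]_n -> T := fun i x => x ord0 i.

Let rV_set0 : g_sigma_preimage coord set0.
Proof. exact: sigma_algebra0. Qed.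

Let rV_setC A : g_sigma_preimage coord A -> g_sigma_preimage coord (~` A).
Proof. exact: sigma_algebraC. Qed.

Let rV_bigcup (F : _^nat) : (forall i, g_sigma_preimage coord (F i)) ->
  g_sigma_preimage coord (\bigcup_i (F i)).
Proof. exact: sigma_algebra_bigcup. Qed.

HB.instance Definition _ := @isMeasurable.Build (measure_rV_display d)
  'rV[T]_n (g_sigma_preimage coord) rV_set0 rV_setC rV_bigcup.

End measurable_rV.

Lemma measurable_rV_coord d (T : measurableType d) n (i : 'I_n) :
  measurable_fun [set: 'rV[T]_n] (fun x => x ord0 i).
Proof.
move=> _ Y mY; rewrite setTI; apply: sub_sigma_algebra => /=.
rewrite -bigcup_seq/=; exists i => /=; first by rewrite mem_index_enum.
by exists Y => //; rewrite setTI.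
Qed.

Lemma measurable_fun_rVP d1 d2 (T1 : measurableType d1) (T2 : measurableType d2)
    n (f : T1 -> 'rV[T2]_n) :
  measurable_fun [set: T1] f <->
  forall i, measurable_fun [set: T1] (fun t => f t ord0 i).
Proof.
split=> [mf i|mf].
  exact: (measurableT_comp (measurable_rV_coord i) mf).
apply: (@measurability _ _ _ _ _ _
  (\big[setU/set0]_(i < n) preimage_set_system setT
     (fun x : 'rV[T2]_n => x ord0 i) measurable)) => //.
move=> _ [B + <-]; rewrite -bigcup_seq/= => -[i _ [A mA <-]].
by rewrite !setTI -[X in measurable X]setTI; exact: mf.
Qed.

Definition rV_cons (R : Type) n (p : R * 'rV[R]_n) : 'rV[R]_n.+1 :=
  row_mx (const_mx p.1 : 'rV_1) p.2.

Definition rV_uncons (R : Type) n (x : 'rV[R]_n.+1) : R * 'rV[R]_n :=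
  (x ord0 ord0, rsubmx (x : 'rV_(1 + n))).

Lemma rV_consK (R : Type) n : cancel (@rV_cons R n) (@rV_uncons R n).
Proof.
case=> x v; rewrite /rV_uncons /rV_cons/= row_mxKr; congr pair.
have -> : (ord0 : 'I_n.+1) = lshift n (ord0 : 'I_1) by exact/val_inj.
by rewrite (row_mxEl (const_mx x : 'rV_1)) mxE.
Qed.

Lemma measurable_rV_uncons d (T : measurableType d) n :
  measurable_fun [set: 'rV[T]_n.+1] (@rV_uncons T n).
Proof.
apply/measurable_fun_pair; first exact: measurable_rV_coord.
apply/measurable_fun_rVP => i.
rewrite (_ : (fun _ => _) = (fun x : 'rV[T]_n.+1 => x ord0 (rshift 1 i))).
  exact: measurable_rV_coord.
by apply/funext => x; rewrite /= mxE.
Qed.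

Lemma measurable_rV_cons d (T : measurableType d) n :
  measurable_fun [set: T * 'rV[T]_n] (@rV_cons T n).
Proof.
apply/measurable_fun_rVP => i.
case: (split_ordP (i : 'I_(1 + n))) => j ij.
- rewrite (_ : (fun _ => _) = fst) ?measurable_fst//.
  by apply/funext => p /=; rewrite /rV_cons ij (row_mxEl (const_mx p.1 : 'rV_1)) mxE.
- rewrite (_ : (fun _ => _) = (fun x : 'rV[T]_n => x ord0 j) \o snd).
    exact: (measurableT_comp (measurable_rV_coord j) measurable_snd).
  by apply/funext => p /=; rewrite /rV_cons ij (row_mxEr (const_mx p.1 : 'rV_1)).
Qed.

(* The image of Lebesgue measure times mu under (x, v) |-> (x :: v). *)
Section lebesgue_cons.
Context {R : realType} {n : nat}.
Variable mu : {sigma_finite_measure set 'rV[R]_n -> \bar R}.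

Definition lebesgue_cons : set 'rV[R]_n.+1 -> \bar R :=
  pushforward (@lebesgue_measure R \x mu)%E (@rV_cons R n).

Let mcons : measurable_fun [set: measurableTypeR R * 'rV[R]_n] (@rV_cons R n).
Proof. exact: measurable_rV_cons. Qed.

Let lebesgue_cons0 : lebesgue_cons set0 = 0%E.
Proof. by rewrite /lebesgue_cons /pushforward preimage_set0 measure0. Qed.

Let lebesgue_cons_ge0 A : (0 <= lebesgue_cons A)%E.
Proof. exact: measure_ge0. Qed.

Let lebesgue_cons_sigma_additive : semi_sigma_additive lebesgue_cons.
Proof.
move=> F mF tF mUF; rewrite /lebesgue_cons /pushforward preimage_bigcup.
apply: measure_semi_sigma_additive.
- by move=> k; rewrite -[X in measurable X]setTI; exact: mcons.
- apply/trivIsetP => /= i j _ _ ij; rewrite -preimage_setI.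
  by move/trivIsetP : tF => /(_ _ _ _ _ ij) ->//; rewrite preimage_set0.
- by rewrite -preimage_bigcup -[X in measurable X]setTI; exact: mcons.
Qed.

HB.instance Definition _ := isMeasure.Build _ _ _ lebesgue_cons
  lebesgue_cons0 lebesgue_cons_ge0 lebesgue_cons_sigma_additive.

Let lebesgue_cons_sigma_finite : sigma_finite setT lebesgue_cons.
Proof.
have /sigma_finiteP[F [UF ndF Foo]] := sigma_finiteT (@lebesgue_measure R).
have /sigma_finiteP[G [UG ndG Goo]] := sigma_finiteT mu.
exists (fun k => @rV_uncons R n @^-1` (F k `*` G k)).
  apply/esym/seteqP; split=> // x _.
  have [i _ Fi] : (\bigcup_k F k) (rV_uncons x).1 by rewrite -UF.
  have [j _ Gj] : (\bigcup_k G k) (rV_uncons x).2 by rewrite -UG.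
  exists (maxn i j) => //; split.
    by apply: (subsetPset _ _ (ndF _ _ _) _ Fi); exact: leq_maxl.
  by apply: (subsetPset _ _ (ndG _ _ _) _ Gj); exact: leq_maxr.
move=> k; have [mF Fk] := Foo k; have [mG Gk] := Goo k; split.
  rewrite -[X in measurable X]setTI; apply: (measurable_rV_uncons measurableT).
  exact: measurableX.
rewrite /lebesgue_cons /pushforward (_ : _ @^-1` _ = F k `*` G k).
  by rewrite product_measure1E// lte_mul_pinfty// ge0_fin_numE.
rewrite -comp_preimage (_ : _ \o _ = id) ?preimage_id//.
by apply/funext => p; exact: rV_consK.
Qed.

HB.instance Definition _ := Measure_isSigmaFinite.Build _ _ _ lebesgue_cons
  lebesgue_cons_sigma_finite.

End lebesgue_cons.

Fixpoint lebesgue_rV {R : realType} (n : nat) :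
    {sigma_finite_measure set 'rV[R]_n -> \bar R} :=
  match n with
  | 0 => \d_(0 : 'rV[R]_0)
  | n'.+1 => lebesgue_cons (lebesgue_rV n')
  end.

Section euclidean_space.
Context {R : realType} {d : nat}.
Implicit Types x y : 'rV[R]_d.

Definition dotv x y : R := \sum_(i < d) x ord0 i * y ord0 i.

(* The library norm `|x| on 'rV[R]_d is the sup norm. *)
Definition enorm x : R := Num.sqrt (dotv x x).

Definition closed_eball (r : R) : set 'rV[R]_d := [set x | enorm x <= r].

Definition isotropic_unimodal (m : set 'rV[R]_d -> \bar R) : Prop :=
  exists m0 : R -> R,
  [/\ forall s, 0 < s -> 0 <= m0 s,
      forall s t, 0 < s -> s <= t -> m0 t <= m0 s &
      forall A : set 'rV[R]_d, measurable A -> ~ A 0 ->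
        m A = (\int[lebesgue_rV d]_(x in A) (m0 (enorm x))%:E)%E].

End euclidean_space.

Definition cexp {R : realType} (z : R[i]) : R[i] :=
  let: Complex a b := z in Complex (expR a * cos b) (expR a * sin b).

Section levy_process.
Context {R : realType} {d : nat} {disp : measure_display}.
Context {Omega : measurableType disp}.

Definition cadlag (f : R -> 'rV[R]_d) : Prop :=
  (forall t, 0 <= t -> f x @[x --> t^'+] --> f t) /\
  (forall t, 0 < t -> cvg (f x @[x --> t^'-])).

Variables (P : probability Omega R) (X : R -> {RV P >-> 'rV[R]_d}).

(* Only the times t >= 0 matter. Stochastic continuity follows from
   levy_stationary and levy_cadlag. *)
Record levy_process : Prop := LevyProcess {
  levy_start : {ae P, forall w, X 0 w = 0};
  levy_independent : forall (n : nat) (t : nat -> R) (B : nat -> set 'rV[R]_d),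
    0 <= t 0%N -> (forall i, t i <= t i.+1) -> (forall i, measurable (B i)) ->
    P (\bigcap_(i < n) [set w | B i (X (t i.+1) w - X (t i) w)]) =
    (\prod_(i < n) P [set w | B i (X (t i.+1) w - X (t i) w)%R])%E;
  levy_stationary : forall (s t : R) (B : set 'rV[R]_d),
    0 <= s -> 0 <= t -> measurable B ->
    P [set w | B (X (s + t) w - X s w)] = P [set w | B (X t w)];
  levy_cadlag : {ae P, forall w, cadlag (X ^~ w)} }.

Definition isotropic_unimodal_process : Prop :=
  forall t, 0 < t -> isotropic_unimodal (distribution P (X t)).

Definition char_fun (Y : Omega -> 'rV[R]_d) (xi : 'rV[R]_d) : R[i] :=
  Complex (fine 'E_P[fun w => cos (dotv xi (Y w))])
          (fine 'E_P[fun w => sin (dotv xi (Y w))]).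

Definition char_exponent (psi : 'rV[R]_d -> R[i]) : Prop :=
  forall t xi, 0 <= t -> char_fun (X t) xi = cexp (- (t%:C%C * psi xi)).

Definition potential (A : set 'rV[R]_d) : \bar R :=
  (\int[P]_w \int[lebesgue_measure]_(t in `[0%R, +oo[) (\1_A (X t w))%:E)%E.

Definition hitting_time (A : set 'rV[R]_d) (x : 'rV[R]_d) (w : Omega) : \bar R :=
  ereal_inf [set t%:E | t in [set t | 0 < t /\ A (x + X t w)]].

(* P^x(T_A < oo), the process started at x being x + X. For Borel A this event
   belongs to the P-completion of the sigma-algebra but possibly not to the
   sigma-algebra itself, whence the outer measure mu_ext P, which agrees with
   the completion of P on such events. *)
Definition hitting_prob (A : set 'rV[R]_d) (x : 'rV[R]_d) : \bar R :=
  mu_ext P [set w | (hitting_time A x w < +oo)%E].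

Definition equilibrium_measure (A : set 'rV[R]_d)
    (rho : {measure set 'rV[R]_d -> \bar R}) : Prop :=
  rho (~` A) = 0%E /\
  forall F : set 'rV[R]_d, measurable F ->
    (\int[rho]_x potential [set (y - x)%R | y in F])%E =
    (\int[lebesgue_rV d]_(x in F) hitting_prob A x)%E.

(* c = Cap(A), the total mass of the equilibrium measure; such a measure exists
   for every non-empty compact A when X is transient. *)
Definition is_capacity (A : set 'rV[R]_d) (c : \bar R) : Prop :=
  exists2 rho, equilibrium_measure A rho & c = rho A.

End levy_process.

(* sup of psi over |x| <= u: the characteristic exponent of an isotropic
   unimodal process is real. *)
Definition psi_star {R : realType} {d : nat} (psi : 'rV[R]_d -> R[i]) (u : R) : R :=
  sup [set complex.Re (psi x) | x in closed_eball u].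

(* Main.v *)
Require Import Defs.
From HB Require Import structures.
From mathcomp Require Import all_boot all_order all_algebra.
From mathcomp Require Import all_classical all_reals all_analysis.
From mathcomp Require Import complex ring lra measurable_realfun.

(** The equilibrium measure [rho] of the closed ball [B_r] satisfies
    [int G(F - x) rho(dx) = int_F P^x(T < oo) dx]. With [F = B_r] the right-hand
    side is at least a multiple of [r ^ d], because the ball is hit at once from
    its interior, and the left-hand side is at most [G(B_2r) * Cap(B_r)]. With
    [F = B_2r] the right-hand side is at most a multiple of [r ^ d], and the
    left-hand side is at least [G(B_r) * Cap(B_r)] ([capacity_ge],
    [capacity_le]). So the statement amounts to [G(B_r)] being of the order of
    [1 / psi^*(1 / r)], with constants that depend on the dimension only.

    Both bounds on [G] rest on one inequality. An isotropic unimodal law is a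
    mixture of uniform laws on centred balls and of an atom at the origin. For
    the uniform law on a ball of radius [R], the mean of [1 - cos <eta, x>] is at
    least a constant times [min(1, |eta| ^ 2 * R ^ 2)]: compare the ball with an
    inscribed cube, on which the integral of the cosine is a product of sinc
    functions. Hence
      [E min(1, |eta| ^ 2 * |X_t| ^ 2) <= K * E (1 - cos <eta, X_t>)]
    ([isotropic_unimodal_truncated_square_le]). Since the law of [X_t] is
    symmetric, [psi] is real and the right-hand side is
    [K * (1 - exp (- t * psi(eta)))]. As [1 - cos <zeta, x>] is at most a
    constant times [max(1, |zeta| ^ 2 / |eta| ^ 2) * min(1, |eta| ^ 2 * |x| ^ 2)],
    dividing by [t] and letting [t] tend to [0] yields
      [psi(zeta) <= C * max(1, |zeta| ^ 2 / |eta| ^ 2) * psi(eta)]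
    for all [zeta] and all [eta <> 0] ([re_exponent_le]). In particular [psi^*(u)]
    is comparable with [psi(eta)] for every [eta] of norm [u].

    Lower bound on [G] ([potential_ball_ge]): with [|eta| = 1 / r], Markov's
    inequality gives [P(|X_t| > r) <= K * t * psi(eta)], so [X_t] is in [B_r] with
    probability at least one half up to a time of order [1 / psi(eta)].

    Upper bound on [G] ([potential_ball_le]): let [S(x)] be the sum of
    [cos <v, x>] over a grid of [N ^ d] frequencies [v] of norm at most [|eta|].
    It is at least [N ^ d / 2] on [B_r], while [E S(X_t) ^ 2] is at most the sum
    over pairs of grid points of [exp (- t * psi(v - v'))]. By the comparison
    above [psi(v - v')] is at least a constant times
    [psi(eta) * |v - v'| ^ 2 / |eta| ^ 2], so at times of order [N ^ 2 / psi(eta)]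
    the double sum is of order [N ^ d] and [P(X_t \in B_r)] is of order
    [N ^ (- d)], that is [(t * psi(eta)) ^ (- d / 2)]. This is integrable in [t]
    at infinity because [3 <= d]. The same restriction on the dimension makes the
    capacity of the origin vanish, since [psi^*(1 / s) * s ^ d] tends to [0] with
    [s]. *)

Set Implicit Arguments.
Unset Strict Implicit.
Unset Printing Implicit Defensive.

Import Order.TTheory GRing.Theory Num.Theory.
Import numFieldNormedType.Exports.

Local Open Scope classical_set_scope.
Local Open Scope ring_scope.

(** * Elementary bounds on sine and cosine *)

Section trigonometric_bounds.
Context {R : realType}.
Implicit Types x y a l : R.

Lemma sqr_le_norm x y : `|x| <= `|y| -> x ^+ 2 <= y ^+ 2.
Proof.
by move=> xy; rewrite -[leLHS]real_normK ?num_real// -[leRHS]real_normK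
  ?num_real// ler_sqr// nnegrE.
Qed.

Lemma sin_mvt x : 0 < x -> exists2 c, 0 < c < x & sin x = x * cos c.
Proof.
move=> x0; have [|c c0x] := @MVT R sin cos 0 x x0 (fun y _ => is_derive_sin y).
  exact/continuous_subspaceT/continuous_sin.
rewrite sin0 !subr0 => E; exists c; last by rewrite E mulrC.
by move: c0x; rewrite in_itv.
Qed.

Lemma norm_sin_le x : `|sin x| <= `|x|.
Proof.
wlog x0 : x / 0 < x.
  move=> H; have [x0|x0|<-] := ltgtP 0 x; first exact: H.
    by rewrite -normrN -sinN -[leRHS]normrN H// oppr_gt0.
  by rewrite sin0.
have [c _ ->] := sin_mvt x0.
by rewrite normrM ler_piMr ?normr_ge0// cos_max.
Qed.

Lemma cos_half x : cos x = 1 - 2 * sin (x / 2) ^+ 2.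
Proof.
rewrite {1}(_ : x = (x / 2) *+ 2); last by rewrite -mulr_natr divfK.
by rewrite cos_mulr2n cos2sin2; lra.
Qed.

Lemma one_sub_cos_le x : 1 - cos x <= x ^+ 2 / 2.
Proof.
rewrite cos_half.
have : sin (x / 2) ^+ 2 <= (x / 2) ^+ 2 by exact/sqr_le_norm/norm_sin_le.
by rewrite expr_div_n; lra.
Qed.

Lemma cos_ge_half x : `|x| <= 1 -> 1 / 2 <= cos x.
Proof.
move=> x1; have := one_sub_cos_le x.
have : x ^+ 2 <= 1 by rewrite -[leRHS](expr1n _ 2) sqr_le_norm// normr1.
lra.
Qed.

Lemma sin_ge_half x : 0 <= x <= 1 -> x / 2 <= sin x.
Proof.
move=> /andP[]; rewrite le_eqVlt => /predU1P[<- _|x0 x1].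
  by rewrite sin0 mul0r.
have [c /andP[c0 cx] ->] := sin_mvt x0.
rewrite ler_pM2l// -[leLHS]mul1r; apply: cos_ge_half.
by rewrite gtr0_norm// (le_trans (ltW cx)).
Qed.

(** For [|x| <= 2] the gap comes from the factor [cos (x/2)] in
    [sin x = 2 sin (x/2) cos (x/2)], and for larger [|x|] from [|sin x| <= 1].
    A gap that is quadratic near [0] and a fixed fraction of [|x|] far away is
    what the comparison of Fourier transforms of balls requires. *)
Lemma norm_sin_le_gap x :
  `|sin x| <= `|x| * (1 - Num.min 1 (x ^+ 2) / 128).
Proof.
wlog x0 : x / 0 < x.
  move=> H; have [x0|x0|<-] := ltgtP 0 x; first exact: H.
    by rewrite -normrN -sinN -[`|x|]normrN -[x ^+ 2]sqrrN H// oppr_gt0.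
  by rewrite sin0 normr0 mul0r.
rewrite (gtr0_norm x0); have [x2|x2] := leP x 2; last first.
  apply: (le_trans (sin_max x)).
  have : Num.min 1 (x ^+ 2) <= 1 by rewrite ge_min lexx.
  nra.
rewrite {1}(_ : x = (x / 2) *+ 2); last by rewrite -mulr_natr divfK.
rewrite sin_mulr2n -mulrnAr normrM mulrC.
have Hs : `|sin (x / 2) *+ 2| <= x.
  rewrite normrMn -[leLHS]mulr_natr -ler_pdivlMr// (le_trans (norm_sin_le _))// gtr0_norm//.
  by rewrite divr_gt0.
have Hc0 : 1 / 2 <= cos (x / 2).
  by apply: cos_ge_half; rewrite gtr0_norm; lra.
rewrite (@ger0_norm _ (cos _)); last by lra.
apply: ler_pM => //; first by lra.
rewrite cos_half.
have : x / 2 / 2 / 2 <= sin (x / 2 / 2) by apply: sin_ge_half; lra.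
have : Num.min 1 (x ^+ 2) <= x ^+ 2 by rewrite ge_min lexx orbT.
nra.
Qed.

(** The integral of [cos (a * u)] over [-l <= u <= l]. *)
Definition cos_mass a l := if a == 0 then 2 * l else 2 * sin (a * l) / a.

Lemma norm_cos_mass_le_gap a l : 0 < l ->
  `|cos_mass a l| <= 2 * l * (1 - Num.min 1 ((a * l) ^+ 2) / 128).
Proof.
move=> l0; rewrite /cos_mass; case: eqVneq => [->|a0].
  rewrite mul0r expr0n/= (min_idPr _)// mul0r subr0 mulr1 gtr0_norm//.
  by rewrite mulr_gt0.
rewrite normrM normfV normrM (ger0_norm (_ : 0 <= 2))// ler_pdivrMr ?normr_gt0//.
have := norm_sin_le_gap (a * l); rewrite normrM (gtr0_norm l0) => H.
rewrite [leRHS](_ : _ =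
  2 * (`|a| * l * (1 - Num.min 1 ((a * l) ^+ 2) / 128))); last by ring.
exact: ler_wpM2l.
Qed.

Lemma norm_cos_mass_le a l : 0 < l -> `|cos_mass a l| <= 2 * l.
Proof.
move=> l0; apply: (le_trans (norm_cos_mass_le_gap a l0)).
apply: ler_piMr; first by rewrite mulr_ge0// ltW.
by rewrite gerBl divr_ge0// le_min ler01 sqr_ge0.
Qed.

Lemma prod_le_factor (I : finType) (F : I -> R) (M : R) (i : I) :
  (forall j, `|F j| <= M) -> `|\prod_j F j| <= M ^+ #|I|.-1 * `|F i|.
Proof.
move=> FM; rewrite (bigD1 i)//= normrM mulrC ler_wpM2r// normr_prod.
rewrite -(cardC1 i) -prodr_const; apply: ler_prod => j _.
by rewrite normr_ge0 FM.
Qed.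

End trigonometric_bounds.

(** * Euclidean space *)

Section euclidean_norm.
Context {R : realType} {d : nat}.
Implicit Types (x y : 'rV[R]_d) (a s : R) (i : 'I_d).

Lemma dotv_ge0 x : 0 <= dotv x x.
Proof. by apply: sumr_ge0 => i _; rewrite -expr2 sqr_ge0. Qed.

Lemma enorm_ge0 x : 0 <= enorm x.
Proof. exact: sqrtr_ge0. Qed.

Lemma sqr_enorm x : enorm x ^+ 2 = dotv x x.
Proof. by rewrite sqr_sqrtr// dotv_ge0. Qed.

Lemma norm_coord_le_enorm x i : `|x ord0 i| <= enorm x.
Proof.
rewrite -sqrtr_sqr ler_sqrt ?dotv_ge0// /dotv (bigD1 i)//= expr2 lerDl.
by apply: sumr_ge0 => j _; rewrite -expr2 sqr_ge0.
Qed.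

Lemma enorm_le_sum x : enorm x <= \sum_i `|x ord0 i|.
Proof.
have S0 : 0 <= \sum_i `|x ord0 i| by apply: sumr_ge0.
rewrite -(ler_pXn2r (_ : 0 < 2)%N)// ?nnegrE ?enorm_ge0//.
rewrite sqr_enorm expr2 mulr_sumr; apply: ler_sum => i _.
rewrite -expr2 -real_normK ?num_real// expr2 ler_wpM2r//.
by rewrite (bigD1 i)//= lerDl sumr_ge0.
Qed.

Lemma enorm_le_dim x a : (forall i, `|x ord0 i| <= a) -> enorm x <= d%:R * a.
Proof.
move=> xa; rewrite (le_trans (enorm_le_sum x))//.
rewrite (le_trans (ler_sum _ (fun i _ => xa i)))//.
by rewrite sumr_const card_ord mulr_natl.
Qed.

Lemma exists_large_coord x : (0 < d)%N ->
  exists i, enorm x <= d%:R * `|x ord0 i|.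
Proof.
move=> d0; pose i0 := Ordinal d0.
exists [arg max_(i > i0) `|x ord0 i|]%O; case: arg_maxP => // i _ xi.
by apply: enorm_le_dim => j; exact: xi.
Qed.

Lemma norm_dotv_le x y : `|dotv x y| <= d%:R * (enorm x * enorm y).
Proof.
rewrite (le_trans (ler_norm_sum _ _ _))//.
rewrite (@le_trans _ _ (\sum_(i < d) enorm x * enorm y))//.
  by apply: ler_sum => i _; rewrite normrM ler_pM// norm_coord_le_enorm.
by rewrite sumr_const card_ord mulr_natl.
Qed.

Lemma dotvC x y : dotv x y = dotv y x.
Proof. by apply: eq_bigr => i _; rewrite mulrC. Qed.

Lemma dotvBl x y z : dotv (x - y) z = dotv x z - dotv y z.
Proof.
by rewrite -sumrB; apply: eq_bigr => i _; rewrite !mxE mulrBl.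
Qed.

Lemma dotvZl a x y : dotv (a *: x) y = a * dotv x y.
Proof. by rewrite mulr_sumr; apply: eq_bigr => i _; rewrite !mxE mulrA. Qed.

Lemma dotvNr x y : dotv x (- y) = - dotv x y.
Proof. by rewrite -sumrN; apply: eq_bigr => i _; rewrite !mxE mulrN. Qed.

Lemma dotv0 x : dotv x 0 = 0.
Proof. by apply: big1 => i _; rewrite !mxE mulr0. Qed.

Lemma enorm0 : enorm (0 : 'rV[R]_d) = 0.
Proof. by rewrite /enorm dotv0 sqrtr0. Qed.

Lemma enorm_eq0 x : (enorm x == 0) = (x == 0).
Proof.
apply/eqP/eqP => [x0|->]; last exact: enorm0.
apply/rowP => i; apply/eqP; rewrite mxE -normr_le0 -x0.
exact: norm_coord_le_enorm.
Qed.

Lemma enorm_gt0 x : (0 < enorm x) = (x != 0).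
Proof. by rewrite lt_def enorm_eq0 enorm_ge0 andbT. Qed.

Lemma enormN x : enorm (- x) = enorm x.
Proof. by rewrite /enorm dotvNr dotvC dotvNr opprK. Qed.

Lemma enormZ a x : 0 <= a -> enorm (a *: x) = a * enorm x.
Proof.
move=> a0; rewrite /enorm dotvZl dotvC dotvZl mulrA -expr2 sqrtrM ?sqr_ge0//.
by rewrite sqrtr_sqr ger0_norm.
Qed.

Lemma enormD_le x y s : enorm x <= s -> enorm y <= s -> enorm (x + y) <= 2 * s.
Proof.
move=> xs ys; have s0 : 0 <= s := le_trans (enorm_ge0 x) xs.
rewrite -(ler_pXn2r (_ : 0 < 2)%N)// ?nnegrE ?enorm_ge0 ?mulr_ge0//.
have : dotv x x <= s ^+ 2.
  by rewrite -sqr_enorm ler_pXn2r// nnegrE enorm_ge0.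
have : dotv y y <= s ^+ 2.
  by rewrite -sqr_enorm ler_pXn2r// nnegrE enorm_ge0.
suff : dotv (x + y) (x + y) <= 2 * dotv x x + 2 * dotv y y.
  by rewrite sqr_enorm; lra.
rewrite !mulr_sumr -big_split; apply: ler_sum => i _ /=; rewrite !mxE.
have := sqr_ge0 (x ord0 i - y ord0 i); lra.
Qed.

Lemma enormB_le x y s : enorm x <= s -> enorm y <= s -> enorm (x - y) <= 2 * s.
Proof. by move=> xs ys; apply: enormD_le => //; rewrite enormN. Qed.

(** Cubes are the only sets whose Lebesgue measure is computed below; balls are
    compared with them. *)
Definition cube (l : R) : set 'rV[R]_d := [set x | forall i, `|x ord0 i| <= l].

Lemma cube_sub_eball l : cube l `<=` closed_eball (d%:R * l).
Proof. by move=> x /= xl; exact: enorm_le_dim. Qed.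

Lemma eball_sub_cube r : closed_eball r `<=` cube r.
Proof. by move=> x /= xr i; exact: le_trans (norm_coord_le_enorm x i) xr. Qed.

Lemma measurable_dotv (x : 'rV[R]_d) : measurable_fun [set: 'rV[R]_d] (dotv x).
Proof.
apply: measurable_sum => i.
by apply: measurable_funM => //; exact: measurable_rV_coord.
Qed.

Lemma measurable_enorm : measurable_fun [set: 'rV[R]_d] enorm.
Proof.
rewrite (_ : enorm = Num.sqrt \o (fun x : 'rV[R]_d => dotv x x))//.
apply: measurableT_comp.
  by apply: continuous_measurable_fun; exact: sqrt_continuous.
by apply: measurable_sum => i; apply: measurable_funM; exact: measurable_rV_coord.
Qed.

Lemma measurable_eball r : measurable (closed_eball r : set 'rV[R]_d).
Proof.
rewrite (_ : closed_eball r = setT `&` enorm @^-1` `]-oo, r]); last first.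
  by rewrite setTI; apply/seteqP; split=> x /=; rewrite in_itv.
by apply: measurable_enorm.
Qed.

Lemma measurable_cube l : measurable (cube l).
Proof.
rewrite (_ : cube l =
    \big[setI/setT]_(i < d) (setT `&` (fun x => x ord0 i) @^-1` `[- l, l])).
  apply: bigsetI_measurable => i _; exact: measurable_rV_coord.
apply/seteqP; split=> [x xl|x].
  by rewrite -bigcap_seq => i _ /=; rewrite in_itv/= -ler_norml; split.
rewrite -bigcap_seq => H i.
have /= [_] := H i (mem_index_enum i).
by rewrite in_itv/= -ler_norml.
Qed.

Lemma measurable_oppv : measurable_fun [set: 'rV[R]_d] (fun x => - x).
Proof.
apply/measurable_fun_rVP => i; under eq_fun do rewrite mxE.
by apply: measurableT_comp => //; exact: measurable_rV_coord.
Qed.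

End euclidean_norm.

Section lebesgue_integration.
Context {R : realType}.
Implicit Types n : nat.

Local Notation leb := (@lebesgue_measure R).

Lemma ge0_integral_lebesgue_rVS n (f : 'rV[R]_n.+1 -> \bar R) :
  measurable_fun setT f -> (forall x, 0 <= f x)%E ->
  (\int[lebesgue_rV n.+1]_x f x =
   \int[leb]_u \int[lebesgue_rV n]_v f (rV_cons (u, v)))%E.
Proof.
move=> mf f0.
rewrite (_ : \int[_]_x f x = \int[pushforward
    (@lebesgue_measure R \x lebesgue_rV n)%E (@rV_cons R n)]_x f x)%E//.
rewrite ge0_integral_pushforward//; last exact: measurable_rV_cons.
rewrite preimage_setT fubini_tonelli1//.
  by apply: measurableT_comp => //; exact: measurable_rV_cons.
by move=> x; exact: f0.
Qed.

Lemma rV_cons_ord0 n (p : R * 'rV[R]_n) : rV_cons p ord0 ord0 = p.1.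
Proof.
rewrite /rV_cons (_ : (ord0 : 'I_n.+1) = lshift n (ord0 : 'I_1)).
  by rewrite (row_mxEl (const_mx p.1 : 'rV_1)) mxE.
exact/val_inj.
Qed.

Lemma rV_cons_lift n (p : R * 'rV[R]_n) (j : 'I_n) :
  rV_cons p ord0 (lift ord0 j) = p.2 ord0 j.
Proof.
rewrite /rV_cons (_ : lift ord0 j = rshift 1 j).
  by rewrite (row_mxEr (const_mx p.1 : 'rV_1)).
exact/val_inj.
Qed.

Lemma rV_consN n (u : R) (v : 'rV[R]_n) : - rV_cons (u, v) = rV_cons (- u, - v).
Proof.
apply/rowP => i; rewrite mxE; case: (unliftP ord0 i) => [j|] ->.
  by rewrite !rV_cons_lift mxE.
by rewrite !rV_cons_ord0.
Qed.

Lemma measurable_rV_cons_comp n (f : 'rV[R]_n.+1 -> \bar R) :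
  measurable_fun setT f ->
  measurable_fun [set: measurableTypeR R * 'rV[R]_n] (f \o @rV_cons R n).
Proof. by move=> mf; apply: measurableT_comp => //; exact: measurable_rV_cons. Qed.

(** It is enough to compare the two measures on half-open intervals. *)
Lemma ge0_integral_lebesgueN (f : R -> \bar R) :
  measurable_fun setT f -> (forall x, 0 <= f x)%E ->
  (\int[leb]_x f (- x)%R = \int[leb]_x f x)%E.
Proof.
move=> mf f0.
have mopp : measurable_fun [set: measurableTypeR R] (-%R : _ -> measurableTypeR R).
  exact: oppr_measurable.
transitivity (\int[pushforward leb (-%R : _ -> measurableTypeR R)]_x f x)%E.
  by rewrite (ge0_integral_pushforward mopp).
apply: eq_measure_integral => A mA _; apply/esym.
apply: (@lebesgue_measure_unique R
  [the measure _ _ of pushforward leb (-%R : _ -> measurableTypeR R)]) => //.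
move=> _ [[a b] _ <-]; rewrite /= /pushforward.
rewrite (_ : -%R @^-1` _ = `[- b, - a[%classic); last first.
  by apply/seteqP; split=> x /=; rewrite !in_itv/= => /andP[? ?]; lra.
rewrite !lebesgue_measure_itv/= !lte_fin ltrN2; case: ifPn => // _.
by rewrite -!EFinB; congr EFin; ring.
Qed.

Lemma ge0_integral_lebesgue_rVN n (f : 'rV[R]_n -> \bar R) :
  measurable_fun setT f -> (forall x, 0 <= f x)%E ->
  (\int[lebesgue_rV n]_x f (- x)%R = \int[lebesgue_rV n]_x f x)%E.
Proof.
elim: n f => [|n IHn] f mf f0.
  by apply: eq_integral => x _; congr f; apply/rowP => -[].
have mfN : measurable_fun [set: 'rV[R]_n.+1] (fun x : 'rV[R]_n.+1 => f (- x)).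
  by apply: measurableT_comp => //; exact: measurable_oppv.
rewrite !ge0_integral_lebesgue_rVS//.
have mfc := measurable_rV_cons_comp mf.
transitivity (\int[leb]_u \int[lebesgue_rV n]_v f (rV_cons (- u, v)%R))%E.
  apply: eq_integral => u _; under eq_integral do rewrite rV_consN.
  rewrite (IHn (fun v => f (rV_cons (- u, v)%R)))//.
  by apply: (measurable_fun_pair2 (f := f \o @rV_cons R n)).
apply: (ge0_integral_lebesgueN (f := fun u =>
   \int[lebesgue_rV n]_v f (rV_cons (u, v))))%E.
- exact: (@measurable_fun_fubini_tonelli_F _ _ _ _ _ (lebesgue_rV n)
    (f \o @rV_cons R n) mfc (fun x => f0 _)).
- by move=> u; exact: integral_ge0.
Qed.

End lebesgue_integration.

(** * Integrals over cubes *)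

Section cube_integrals.
Context {R : realType}.
Implicit Types (a b l u : R) (n : nat).

Local Notation leb := (@lebesgue_measure R).

Lemma integral_affine_cos a b l (A B : R) : 0 < l ->
  (\int[leb]_(u in `[(- l)%R, l]) (A - B * cos (a * u + b))%:E =
   (2 * l * A - B * (cos b * cos_mass a l))%:E)%E.
Proof.
move=> l0; rewrite /cos_mass; case: eqVneq => [->|a0].
  under eq_integral do rewrite mul0r add0r.
  rewrite integral_cst//= lebesgue_measure_itv/= lte_fin gtrN// -EFinD -EFinM.
  by congr EFin; ring.
pose F u := A * u - B * (sin (a * u + b) / a).
have dF u : is_derive u 1 F (A - B * cos (a * u + b)).
  rewrite /F; apply: is_derive_eq; rewrite /GRing.scale/=.
  by field.
have cF : continuous F.
  move=> u; apply: differentiable_continuous; apply/derivable1_diffP.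
  by have [] := dF u.
rewrite (@continuous_FTC2 _ _ F)//.
- rewrite -EFinB; congr EFin; rewrite /F (mulrN a l) !sinD sinN cosN; field.
  exact: a0.
- by rewrite gtrN.
- apply: continuous_subspaceT => u.
  apply: cvgB; first exact: cvg_cst.
  apply: cvgM; first exact: cvg_cst.
  apply: continuous_comp; last exact: continuous_cos.
  by apply: cvgD; [apply: cvgM; [exact: cvg_cst|exact: cvg_id]|exact: cvg_cst].
- split.
  + by move=> u _; have [] := dF u.
  + exact: cvg_at_right_filter (cF _).
  + exact: cvg_at_left_filter (cF _).
- by move=> u _; rewrite derive1E; apply: derive_val.
Qed.

Lemma dotv_rV_cons n (eta : 'rV[R]_n.+1) (u : R) (v : 'rV[R]_n) :
  dotv eta (rV_cons (u, v)) =
  eta ord0 ord0 * u + dotv (\row_j eta ord0 (lift ord0 j)) v.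
Proof.
rewrite /dotv big_ord_recl rV_cons_ord0/=; congr (_ + _).
by apply: eq_bigr => j _; rewrite rV_cons_lift mxE.
Qed.

Lemma cube_rV_cons n l (u : R) (v : 'rV[R]_n) :
  cube l (rV_cons (u, v)) <-> `[- l, l]%classic u /\ cube l v.
Proof.
rewrite /cube/= in_itv/= -ler_norml; split=> [H|[ul vl] i].
  split=> [|j]; first by have := H ord0; rewrite rV_cons_ord0.
  by have := H (lift ord0 j); rewrite rV_cons_lift.
by case: (unliftP ord0 i) => [j|] ->; rewrite ?rV_cons_lift ?rV_cons_ord0.
Qed.

Lemma measurable_cos_dotv n (eta : 'rV[R]_n) b :
  measurable_fun [set: 'rV[R]_n] (fun x => cos (dotv eta x + b)).
Proof.
apply: (measurableT_comp (f := cos)).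
  by apply: continuous_measurable_fun; exact: continuous_cos.
by apply: measurable_funD => //; exact: measurable_dotv.
Qed.

Lemma measurable_one_sub_cos_dotv n (eta : 'rV[R]_n) b :
  measurable_fun [set: 'rV[R]_n] (fun x => (1 - cos (dotv eta x + b))%:E).
Proof.
by apply/measurable_EFinP; apply: measurable_funB => //; exact: measurable_cos_dotv.
Qed.

(** The phase [b] is what makes the induction on the dimension go through:
    integrating out one coordinate shifts it. *)
Lemma integral_cube_cos n (eta : 'rV[R]_n) b l : 0 < l ->
  (\int[lebesgue_rV n]_(x in cube l) (1 - cos (dotv eta x + b))%:E =
   ((2 * l) ^+ n - cos b * \prod_i cos_mass (eta ord0 i) l)%:E)%E.
Proof.
move=> l0; elim: n eta b => [|n IHn] eta b.
  rewrite (_ : cube l = setT); last by apply/seteqP; split => // x _ [].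
  rewrite integral_dirac//; last exact: measurable_one_sub_cos_dotv.
  rewrite diracE mem_set// mul1e big_ord0 expr0 mulr1.
  by rewrite /dotv big_ord0 add0r.
pose f (x : 'rV[R]_n.+1) : \bar R := (1 - cos (dotv eta x + b))%:E.
have f0 x : (0 <= f x)%E by rewrite lee_fin subr_ge0 cos_le1.
have mf : measurable_fun setT f by exact: measurable_one_sub_cos_dotv.
rewrite integral_mkcond ge0_integral_lebesgue_rVS; last 2 first.
- apply/(measurable_restrictT _ _).1 => //; first exact: measurable_cube.
  exact: measurable_funTS.
- by move=> x; apply: erestrict_ge0 => y _; exact: f0.
pose eta' : 'rV[R]_n := \row_j eta ord0 (lift ord0 j).
transitivity (\int[leb]_(u in `[(- l)%R, l])
   ((2 * l) ^+ n - (\prod_i cos_mass (eta' ord0 i) l) *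
       cos (eta ord0 ord0 * u + b))%:E)%E.
  rewrite [RHS]integral_mkcond; apply: eq_integral => u _.
  rewrite patchE; case: ifPn => [|] ul.
    rewrite [_ * cos _]mulrC -IHn [RHS]integral_mkcond; apply: eq_integral => v _.
    rewrite !patchE /f dotv_rV_cons addrA [_ + dotv _ _]addrC.
    rewrite (_ : (rV_cons (u, v) \in cube l) = (v \in cube l)) ?addrA//.
    apply/idP/idP => /set_mem; last by move=> vl; apply/mem_set/cube_rV_cons; split=> //; exact: set_mem.
    by case/cube_rV_cons => _ /mem_set.
  apply: integral0_eq => v _; rewrite patchE ifF//; apply/negbTE.
  apply: contra ul => /set_mem/cube_rV_cons[ul _]; exact: mem_set.
rewrite integral_affine_cos// exprS big_ord_recl; congr EFin.
rewrite (_ : \prod_(j < n) cos_mass (eta ord0 (lift ord0 j)) l =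
  \prod_j cos_mass (eta' ord0 j) l); first by ring.
by apply: eq_bigr => j _; rewrite mxE.
Qed.

Lemma lebesgue_cube n l : 0 < l ->
  lebesgue_rV n (cube l : set 'rV[R]_n) = ((2 * l) ^+ n)%:E.
Proof.
move=> l0; have := @integral_cube_cos n 0 (pi / 2) l l0.
rewrite cos_pihalf mul0r subr0 => <-.
rewrite -[LHS]mul1e -integral_cst; last exact: measurable_cube.
apply: eq_integral => x _.
by rewrite dotvC dotv0 add0r cos_pihalf subr0.
Qed.

Lemma integral_cube1 n l : 0 < l ->
  (\int[lebesgue_rV n]_(x in cube l : set 'rV[R]_n) 1 = ((2 * l) ^+ n)%:E)%E.
Proof.
move=> l0; rewrite integral_cst; last exact: measurable_cube.
by rewrite mul1e; exact: lebesgue_cube.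
Qed.

(** All factors but one of the product of one-dimensional integrals are bounded
    by [2 * l], so each coordinate of [eta] gives its own lower bound; this takes
    the place of a rotation of [eta] onto an axis. *)
Lemma integral_cube_one_sub_cos_ge n (eta : 'rV[R]_n) (i : 'I_n) l : 0 < l ->
  (((2 * l) ^+ n * (Num.min 1 ((eta ord0 i * l) ^+ 2) / 128))%:E <=
   \int[lebesgue_rV n]_(x in cube l) (1 - cos (dotv eta x))%:E)%E.
Proof.
move=> l0; have := @integral_cube_cos n eta 0 l l0.
under eq_integral do rewrite addr0.
move=> ->; rewrite lee_fin cos0 mul1r.
set m := Num.min _ _.
have := @prod_le_factor R 'I_n (fun j => cos_mass (eta ord0 j) l) (2 * l) i
  (fun j => norm_cos_mass_le _ l0).
rewrite card_ord => H.
have := norm_cos_mass_le_gap (eta ord0 i) l0; rewrite -/m => H2.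
have {}H := le_trans (ler_norm _) (le_trans H (ler_wpM2l _ H2)).
have E : (2 * l) ^+ n = (2 * l) ^+ n.-1 * (2 * l).
  by rewrite -exprSr prednK// (leq_ltn_trans _ (ltn_ord i)).
have {}H := H (exprn_ge0 _ (mulr_ge0 (ler0n _ 2) (ltW l0))).
by rewrite E; lra.
Qed.

End cube_integrals.

(** * Layer-cake formula and radial densities *)

Section comparison_sets.
Context {R : realType} {disp : measure_display} {T : measurableType disp}.
Variables (f g : T -> R).
Hypotheses (mf : measurable_fun setT f) (mg : measurable_fun setT g).

Lemma measurable_lt_set : measurable [set x | f x < g x].
Proof.
rewrite (_ : mkset _ = setT `&` (fun x => f x < g x) @^-1` [set true]).
  exact: measurable_fun_ltr.
by rewrite setTI; apply/seteqP; split=> x.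
Qed.

Lemma measurable_le_set : measurable [set x | f x <= g x].
Proof.
rewrite (_ : mkset _ = setT `&` (fun x => f x <= g x) @^-1` [set true]).
  exact: measurable_fun_ler.
by rewrite setTI; apply/seteqP; split=> x.
Qed.

End comparison_sets.

Section layer_cake.
Context {R : realType} {disp : measure_display} {T : measurableType disp}.
Variable mu : {sigma_finite_measure set T -> \bar R}.

Local Notation leb := (@lebesgue_measure R).

Lemma integral_lt_indic (a : R) : 0 <= a ->
  (\int[leb]_(s in `[0%R, +oo[) (\1_[set s | s < a] s)%:E = a%:E)%E.
Proof.
move=> a0; rewrite integral_indic//; last by rewrite (_ : mkset _ = `]-oo, a[%classic).
rewrite (_ : _ `&` _ = `[0, a[%classic); last first.
  apply/seteqP; split=> s; rewrite /= !in_itv/= ?andbT; first by case=> -> ->.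
  by move=> /andP[].
rewrite /= lebesgue_measure_itv/= lte_fin oppr0 adde0.
by case: ltP => // a0'; congr EFin; apply/eqP; rewrite eq_le a0 a0'.
Qed.

(** Tonelli's theorem for the region under the graph of [f]. The weight [h] lets
    the same formula serve when [f] is a test function and when [f] is a
    density. *)
Lemma layer_cake (h : T -> \bar R) (f : T -> R) :
  measurable_fun setT h -> (forall x, 0 <= h x)%E ->
  measurable_fun setT f -> (forall x, 0 <= f x) ->
  (\int[mu]_x (h x * (f x)%:E) =
   \int[leb]_(s in `[0%R, +oo[) \int[mu]_(x in [set x | (s < f x)%R]) h x)%E.
Proof.
move=> mh h0 mf f0.
pose A : set (T * measurableTypeR R) := [set p | 0 <= p.2 < f p.1].
have mfst : measurable_fun [set: T * measurableTypeR R] (f \o fst).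
  by apply: measurableT_comp => //; exact: measurable_fst.
have msnd : measurable_fun [set: T * measurableTypeR R] (snd : _ -> R).
  exact: measurable_snd.
have mA : measurable A.
  rewrite (_ : A = [set p | 0 <= p.2] `&` [set p | p.2 < f p.1]).
    by apply: measurableI; [exact: measurable_le_set|exact: measurable_lt_set].
  apply/seteqP; split=> p /=; first by move/andP.
  by case=> p0 pf; apply/andP; split.
pose g (p : T * measurableTypeR R) : \bar R := (h p.1 * (\1_A p)%:E)%E.
have g0 p : (0 <= g p)%E by rewrite mule_ge0// lee_fin.
have mg : measurable_fun setT g.
  apply: emeasurable_funM; first by apply: measurableT_comp => //; exact: measurable_fst.
  by apply/measurable_EFinP; exact: measurable_indic.
transitivity (\int[mu]_x \int[leb]_s g (x, s))%E.
  apply: eq_integral => x _; rewrite -(integral_lt_indic (f0 x)).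
  rewrite -ge0_integralZl//; last first.
    apply/measurable_EFinP; apply: measurable_indic.
    by rewrite (_ : mkset _ = `]-oo, f x[%classic).
  rewrite integral_mkcond; apply: eq_integral => s _.
  rewrite patchE /g/= !indicE; case: ifPn => [/set_mem|].
    rewrite /= in_itv/= andbT => s0; congr (_ * (_%:R)%:E)%E; congr nat_of_bool.
    by apply/idP/idP => /set_mem H; apply/mem_set; rewrite /A/= in H *;
      [rewrite s0|case/andP: H].
  rewrite /A notin_setE/= in_itv/= andbT => /negP s0.
  by rewrite memNset ?mule0//= (negbTE s0).
rewrite fubini_tonelli//= [RHS]integral_mkcond; apply: eq_integral => s _.
rewrite patchE; case: ifPn => [/set_mem|].
  rewrite /= in_itv/= andbT => s0; rewrite [RHS]integral_mkcond.
  apply: eq_integral => x _; rewrite /g patchE/= indicE.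
  rewrite (_ : (_ \in A) = (x \in [set x | s < f x])); last first.
    by apply/idP/idP => /set_mem H; apply/mem_set; rewrite /A/= in H *;
      [case/andP: H|rewrite s0].
  by case: ifPn => _; rewrite ?mule1 ?mule0.
rewrite notin_setE/= in_itv/= andbT => /negP s0.
apply: integral0_eq => x _.
by rewrite /g indicE memNset ?mule0//= /A/= (negbTE s0).
Qed.

End layer_cake.

Section unimodal_density.
Context {R : realType} {d : nat}.
Variable m : probability 'rV[R]_d R.

Local Notation leb := (@lebesgue_measure R).

(** Outside the origin the radial profile defines a density; its value at the
    origin is arbitrary, which is why only test functions vanishing there can
    be integrated (the law may have an atom). *)
Lemma isotropic_unimodal_density : isotropic_unimodal m ->
  exists M : 'rV[R]_d -> R,
  [/\ measurable_fun setT M, forall x, 0 <= M x,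
      forall x y, y != 0 -> enorm y <= enorm x -> M x <= M y,
      forall x, M (- x) = M x &
      forall f : 'rV[R]_d -> R, measurable_fun setT f ->
        (forall x, 0 <= f x) -> f 0 = 0 ->
        (\int[m]_x (f x)%:E = \int[lebesgue_rV d]_x ((M x)%:E * (f x)%:E))%E].
Proof.
move=> [m0 [m0_ge0 m0_dec mE]].
pose m1 : R -> R := m0 \_ `]0, +oo[.
have m1E s : 0 < s -> m1 s = m0 s.
  by move=> s0; rewrite /m1 patchE ifT//; apply/mem_set; rewrite /= in_itv/= s0.
have m1E0 s : s <= 0 -> m1 s = 0.
  move=> s0; rewrite /m1 patchE ifF//; apply/negP => /set_mem.
  by rewrite /= in_itv/= andbT ltNge s0.
have m1_ge0 s : 0 <= m1 s.
  by have [s0|s0] := ltP 0 s; [rewrite m1E// m0_ge0|rewrite m1E0].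
have mm1 : measurable_fun setT m1.
  apply/(measurable_restrictT _ _).1 => //.
  apply: (measurability (@RGenCInfty.G R)) => [|/= _ [_] [r] -> <-].
    exact: RGenCInfty.measurableE.
  apply: is_interval_measurable => s t/=; rewrite !in_itv/= !andbT.
  move=> [s0 fs] [t0 ft] u /andP[su ut].
  have u0 : 0 < u := lt_le_trans s0 su.
  by rewrite !in_itv/= !andbT u0 (le_trans ft)// m0_dec.
pose M (x : 'rV[R]_d) := m1 (enorm x).
have mM : measurable_fun setT M by exact: (measurableT_comp mm1 measurable_enorm).
exists M; split => //.
- by move=> x; exact: m1_ge0.
- move=> x y y0 yx; have ey : 0 < enorm y by rewrite enorm_gt0.
  by rewrite /M !m1E ?(lt_le_trans ey)// m0_dec.
- by move=> x; rewrite /M enormN.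
move=> f mf f_ge0 f0.
transitivity (\int[m]_x (1%E * (f x)%:E))%E.
  by apply: eq_integral => x _; rewrite mul1e.
rewrite layer_cake// layer_cake//; last first.
- by move=> x; rewrite lee_fin m1_ge0.
- by apply/measurable_EFinP.
apply: eq_integral => s /set_mem; rewrite /= in_itv/= andbT => s0.
have mfs : measurable [set x | s < f x].
  exact: measurable_lt_set.
rewrite integral_cst// mul1e.
transitivity (m [set x | s < f x]) => //.
rewrite mE//; last by rewrite /= f0 ltNge s0.
apply: eq_integral => x /set_mem/= sx; congr EFin; rewrite /M m1E//.
rewrite enorm_gt0; apply/eqP => x0; move: sx; rewrite x0 f0.
by rewrite ltNge s0.
Qed.

End unimodal_density.

(** * Test functions against an isotropic unimodal law *)

Section monotone_integral.
Context {R : realType} {disp : measure_display} {T : measurableType disp}.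
Variable mu : {measure set T -> \bar R}.

(** The integral of a nonnegative function is a supremum over simple functions,
    hence monotone even for non-measurable integrands; hitting probabilities
    and translates of the potential measure are integrated this way. *)
Lemma le_integral_patch (D1 D2 : set T) (f1 f2 : T -> \bar R) :
  (forall x, D1 x -> 0 <= f1 x)%E -> (forall x, D2 x -> 0 <= f2 x)%E ->
  (forall x, (f1 \_ D1) x <= (f2 \_ D2) x)%E ->
  (\int[mu]_(x in D1) f1 x <= \int[mu]_(x in D2) f2 x)%E.
Proof.
move=> f10 f20 f12; rewrite !ge0_integralE//.
apply: le_ereal_sup => _ [h hf1 <-]; exists h => // x.
exact: le_trans (hf1 x) (f12 x).
Qed.

End monotone_integral.

Section radial_comparison.
Context {R : realType} {d : nat}.
Hypothesis d0 : (0 < d)%N.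
Implicit Types (eta x y : 'rV[R]_d) (D : set 'rV[R]_d).

Definition truncated_square eta x : R := Num.min 1 ((enorm eta * enorm x) ^+ 2).

Definition one_sub_cos eta x : R := 1 - cos (dotv eta x).

(** [(2 * d) ^+ d] is the volume ratio of the cubes circumscribed about a ball
    and inscribed in the concentric ball of half its radius, [4 * d ^+ 4]
    compares [|eta| * |x|] with one coordinate, and [128] comes from
    [norm_sin_le_gap]. *)
Definition radial_const : R := (2 * d%:R) ^+ d * (4 * d%:R ^+ 4) * 128.

Lemma dR_ge1 : 1 <= d%:R :> R.
Proof. by rewrite ler1n. Qed.

Lemma radial_const_gt0 : 0 < radial_const.
Proof.
have d1 : 0 < d%:R :> R := lt_le_trans ltr01 dR_ge1.
by rewrite /radial_const pmulr_lgt0// mulr_gt0 ?exprn_gt0 ?mulr_gt0 ?exprn_gt0.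
Qed.

Lemma truncated_square_ge0 eta x : 0 <= truncated_square eta x.
Proof. by rewrite le_min ler01 sqr_ge0. Qed.

Lemma one_sub_cos_ge0 eta x : 0 <= one_sub_cos eta x.
Proof. by rewrite subr_ge0 cos_le1. Qed.

Lemma measurable_truncated_square eta :
  measurable_fun [set: 'rV[R]_d] (truncated_square eta).
Proof.
apply: measurable_minr => //; apply: measurable_funX.
by apply: measurable_funM => //; exact: measurable_enorm.
Qed.

Lemma measurable_one_sub_cos eta :
  measurable_fun [set: 'rV[R]_d] (one_sub_cos eta).
Proof.
rewrite (_ : one_sub_cos eta = (fun x => 1 - cos (dotv eta x + 0))).
  by apply: measurable_funB => //; exact: measurable_cos_dotv.
by apply/funext => x; rewrite addr0.
Qed.

Lemma integral_one_sub_cos_ge eta (i : 'I_d) l D : 0 < l ->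
  (forall y, cube l y -> y != 0 -> D y) ->
  (((2 * l) ^+ d * (Num.min 1 ((eta ord0 i * l) ^+ 2) / 128))%:E <=
   \int[lebesgue_rV d]_(x in D) (one_sub_cos eta x)%:E)%E.
Proof.
move=> l0 lD; apply: le_trans (integral_cube_one_sub_cos_ge eta i l0) _.
apply: le_integral_patch => [x _|x _|x].
- by rewrite lee_fin one_sub_cos_ge0.
- by rewrite lee_fin one_sub_cos_ge0.
rewrite !patchE; case: ifPn => xl.
  have [->|x0] := eqVneq x 0.
    by rewrite /one_sub_cos dotv0 cos0 subrr; case: ifPn.
  by rewrite ifT//; apply/mem_set/lD => //; exact: set_mem.
by case: ifPn => _ //; rewrite lee_fin one_sub_cos_ge0.
Qed.

Lemma integral_truncated_square_le eta r D : 0 < r ->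
  D `<=` closed_eball r ->
  (\int[lebesgue_rV d]_(x in D) (truncated_square eta x)%:E <=
   ((2 * r) ^+ d * Num.min 1 ((enorm eta * r) ^+ 2))%:E)%E.
Proof.
move=> r0 Dr; rewrite EFinM -lebesgue_cube// muleC -integral_cst; last first.
  exact: measurable_cube.
apply: le_integral_patch => [x _|x _|x].
- by rewrite lee_fin truncated_square_ge0.
- by rewrite lee_fin le_min ler01 sqr_ge0.
rewrite !patchE; case: ifPn => xD; last first.
  by case: ifPn => _ //; rewrite lee_fin le_min ler01 sqr_ge0.
have /Dr xr := set_mem xD.
rewrite ifT; last by apply/mem_set; exact: eball_sub_cube.
rewrite lee_fin le_min2//.
by rewrite sqr_le_norm// !normrM ler_wpM2l// !ger0_norm// ?enorm_ge0// ltW.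
Qed.

(** Level sets of a radially decreasing density are balls. On a ball of radius
    [r], both integrals are of order [r ^+ d * min(1, |eta|^2 * r^2)]; on the
    whole space the right-hand side is infinite. *)
Lemma integral_radial_le eta D :
  (forall x y, D x -> y != 0 -> enorm y <= enorm x -> D y) ->
  (\int[lebesgue_rV d]_(x in D) (truncated_square eta x)%:E <=
   radial_const%:E * \int[lebesgue_rV d]_(x in D) (one_sub_cos eta x)%:E)%E.
Proof.
move=> Drad.
have d1 := dR_ge1.
have Kgt0 := radial_const_gt0.
have g_ge0 : (0 <= \int[lebesgue_rV d]_(x in D) (one_sub_cos eta x)%:E)%E.
  by apply: integral_ge0 => x _; rewrite lee_fin one_sub_cos_ge0.
have rhs_ge0 := mule_ge0 (_ : 0 <= radial_const%:E)%E g_ge0.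
have {}rhs_ge0 := rhs_ge0 (ltW Kgt0).
have [i etai] := exists_large_coord eta d0.
have [eta0|eta0] := eqVneq eta 0.
  rewrite [leLHS]integral0_eq; first exact: rhs_ge0.
  move=> x _.
  by rewrite /truncated_square eta0 enorm0 mul0r expr0n/= (min_idPr _).
have etai0 : 0 < `|eta ord0 i|.
  have : 0 < enorm eta by rewrite enorm_gt0.
  move=> /lt_le_trans/(_ etai); rewrite pmulr_rgt0//.
  exact: lt_le_trans ltr01 d1.
have [[x [Dx x0]]|Dsub0] := pselect (exists x, D x /\ x != 0); last first.
  rewrite [leLHS]integral0_eq; first exact: rhs_ge0.
  move=> x Dx.
  have [->|x0] := eqVneq x 0; last by exfalso; apply: Dsub0; exists x.
  by rewrite /truncated_square enorm0 mulr0 expr0n/= (min_idPr _).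
pose E := [set enorm x | x in D].
have E0 : E !=set0 by exists (enorm x), x.
have [ubE|nubE] := pselect (has_ubound E).
  pose r := sup E.
  have r0 : 0 < r.
    apply: (@lt_le_trans _ _ (enorm x)); first by rewrite enorm_gt0.
    by apply: sup_upper_bound; [split|exists x].
  have D0 : 0 < 2 * d%:R :> R by rewrite mulr_gt0// (lt_le_trans ltr01 d1).
  have [l l0 rE] : exists2 l, 0 < l & r = 2 * d%:R * l.
    by exists (r / (2 * d%:R)); [exact: divr_gt0|rewrite mulrC divfK ?gt_eqF].
  apply: (le_trans (@integral_truncated_square_le eta r D r0 _)).
    by move=> y Dy; apply: sup_upper_bound; [split|exists y].
  have Hl := @integral_one_sub_cos_ge eta i l D l0.
  apply: (le_trans _ (lee_wpmul2l _ (Hl _))); last 2 first.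
  - by rewrite lee_fin ltW.
  - move=> y yl y0.
    have [|_ [z Dz <-] yz] := @sup_adherent _ E (r / 2) _ (conj E0 ubE).
      by rewrite divr_gt0.
    apply: (Drad z) => //; apply: le_trans (ltW yz).
    by rewrite -/r (le_trans (cube_sub_eball yl))// rE; lra.
  rewrite -EFinM lee_fin /radial_const.
  set m := Num.min 1 ((eta ord0 i * l) ^+ 2).
  have mle : Num.min 1 ((enorm eta * r) ^+ 2) <= 4 * d%:R ^+ 4 * m.
    have K1 : 1 <= 4 * d%:R ^+ 4 :> R.
      by have := exprn_ege1 4 d1; lra.
    rewrite /m minr_pMr; last by lra.
    rewrite mulr1 le_min2//.
    rewrite (_ : 4 * _ * _ = (2 * d%:R ^+ 2 * (eta ord0 i * l)) ^+ 2); last by ring.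
    apply: sqr_le_norm; rewrite !normrM (ger0_norm (enorm_ge0 _)).
    rewrite (gtr0_norm r0) (gtr0_norm l0) rE !normr_nat.
    rewrite [leRHS](_ : _ = (d%:R * `|eta ord0 i|) * (2 * d%:R * l)); last by ring.
    by rewrite ler_wpM2r// !mulr_ge0// ltW.
  rewrite rE (_ : 2 * (2 * d%:R * l) = (2 * d%:R) * (2 * l)); last by ring.
  rewrite exprMn [leRHS](_ : _ = (2 * d%:R) ^+ d * (2 * l) ^+ d * (4 * d%:R ^+ 4 * m)).
    by rewrite -rE ler_wpM2l// mulr_ge0 ?exprn_ge0 ?mulr_ge0 ?(ltW l0).
  by field.
(* an unbounded radial set contains everything but possibly the origin *)
have Dall y : y != 0 -> D y.
  move=> y0; apply: contrapT => nDy; apply: nubE; exists (enorm y) => _ [z Dz <-].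
  rewrite leNgt; apply/negP => yz; apply: nDy.
  by apply: (Drad z) => //; exact: ltW.
suff -> : (\int[lebesgue_rV d]_(x in D) (one_sub_cos eta x)%:E = +oo)%E.
  by rewrite gt0_muley ?leey// lte_fin.
apply/eqyP => A A0.
(* [l] makes the minimum equal to [1], and [(2 * l) ^+ d / 128 >= A] *)
pose l := Num.max `|eta ord0 i|^-1 (Num.max 1 (128 * A)).
have l1 : 1 <= l by rewrite !le_max lexx orbT.
have l0 : 0 < l by exact: lt_le_trans ltr01 l1.
have Hl := @integral_one_sub_cos_ge eta i l D l0 (fun y _ => @Dall y).
apply: (le_trans _ Hl).
rewrite lee_fin (min_idPl _); last first.
  rewrite -[leLHS](expr1n _ 2) sqr_le_norm// normr1 normrM (gtr0_norm l0).
  by rewrite -ler_pdivrMl// mulr1 le_max lexx.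
have : 128 * A <= l by rewrite !le_max lexx !orbT.
have : 2 * l <= (2 * l) ^+ d.
  by rewrite -[leLHS]expr1 ler_weXn2l//; lra.
lra.
Qed.

(** The comparison on balls is integrated over the level sets of the density. An
    atom at the origin does not matter, as both test functions vanish there. *)
Lemma isotropic_unimodal_truncated_square_le (m : probability 'rV[R]_d R) eta :
  isotropic_unimodal m ->
  (\int[m]_x (truncated_square eta x)%:E <=
   radial_const%:E * \int[m]_x (one_sub_cos eta x)%:E)%E.
Proof.
move=> /isotropic_unimodal_density[M [mM M0 Mrad _ ME]].
have mf := measurable_truncated_square eta.
have mg := measurable_one_sub_cos eta.
have f0 := truncated_square_ge0 eta.
have g0 := one_sub_cos_ge0 eta.
have mEf := (measurable_EFinP _ _).2 mf.
have mEg := (measurable_EFinP _ _).2 mg.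
have K0 := ltW radial_const_gt0.
rewrite -ge0_integralZl//; last by move=> x _; rewrite lee_fin.
under [leRHS]eq_integral do rewrite -EFinM.
have mKg : measurable_fun setT (fun x => radial_const * one_sub_cos eta x).
  exact: measurable_funM.
have mEKg := (measurable_EFinP _ _).2 mKg.
rewrite (ME (fun x => radial_const * one_sub_cos eta x))//; last 2 first.
- by move=> x; rewrite mulr_ge0.
- by rewrite /one_sub_cos dotv0 cos0 subrr mulr0.
rewrite ME//; last first.
  by rewrite /truncated_square enorm0 mulr0 expr0n/= (min_idPr _).
under eq_integral do rewrite muleC.
under [leRHS]eq_integral do rewrite muleC.
rewrite !layer_cake//; last by move=> x; rewrite lee_fin mulr_ge0.
apply: le_integral_patch => [s _|s _|s].
- by apply: integral_ge0 => x _; rewrite lee_fin.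
- by apply: integral_ge0 => x _; rewrite lee_fin mulr_ge0.
rewrite !patchE; case: ifPn => // _.
under [leRHS]eq_integral do rewrite EFinM.
rewrite ge0_integralZl//; last 3 first.
- exact: measurable_lt_set.
- exact: measurable_funTS.
- by move=> x _; rewrite lee_fin.
apply: integral_radial_le => x y /= sx y0 yx.
by rewrite (lt_le_trans sx)// Mrad.
Qed.

End radial_comparison.

(** * The characteristic exponent *)

Section exponent.
Context {R : realType} {d : nat} {disp : measure_display}.
Context {Omega : measurableType disp} {P : probability Omega R}.
Variable X : R -> {RV P >-> 'rV[R]_d}.
Variable psi : 'rV[R]_d -> R[i].
Hypothesis d0 : (0 < d)%N.
Hypothesis X_unimodal : isotropic_unimodal_process X.
Hypothesis X_psi : char_exponent X psi.
Implicit Types (xi eta zeta : 'rV[R]_d) (t : R).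

Definition re_exponent xi : R := complex.Re (psi xi).

Lemma measurable_cos_RV (Y : {RV P >-> 'rV[R]_d}) xi :
  measurable_fun [set: Omega] (fun w => cos (dotv xi (Y w))).
Proof.
rewrite (_ : (fun w => _) = (fun x => cos (dotv xi x + 0)) \o Y).
  apply: measurableT_comp => //; exact: measurable_cos_dotv.
by apply/funext => w /=; rewrite addr0.
Qed.

Lemma integrable_cos_RV (Y : {RV P >-> 'rV[R]_d}) xi :
  P.-integrable setT (fun w => (cos (dotv xi (Y w)))%:E).
Proof.
apply: measurable_bounded_integrable => //.
- by rewrite (le_lt_trans (probability_le1 _ _))// ltry.
- exact: measurable_cos_RV.
- exists 1; split => // M M1 w _; exact: le_trans (cos_max _) (ltW M1).
Qed.

Lemma ge0_integral_law (Y : {RV P >-> 'rV[R]_d}) (h : 'rV[R]_d -> R) :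
  measurable_fun setT h -> (forall x, 0 <= h x) ->
  (\int[distribution P Y]_x (h x)%:E = \int[P]_w (h (Y w))%:E)%E.
Proof.
move=> mh h0; apply: (ge0_integral_distribution Y) => //.
exact/measurable_EFinP.
Qed.

(** The density is even, so the positive and negative parts of the sine have
    equal integrals. *)
Lemma expectation_sin_eq0 (Y : {RV P >-> 'rV[R]_d}) xi :
  isotropic_unimodal (distribution P Y) ->
  fine ('E_P[fun w => sin (dotv xi (Y w))]) = 0.
Proof.
move=> /isotropic_unimodal_density[M [mM M0 _ MN ME]].
pose f x := Num.max (sin (dotv xi x)) 0.
have mf : measurable_fun [set: 'rV[R]_d] f.
  apply: measurable_maxr => //.
  apply: measurableT_comp; last exact: measurable_dotv.
  by apply: continuous_measurable_fun; exact: continuous_sin.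
have f_ge0 x : 0 <= f x by rewrite le_max lexx orbT.
have fv0 : f 0 = 0 by rewrite /f dotv0 sin0 maxxx.
pose f' x := f (- x).
have mf' : measurable_fun [set: 'rV[R]_d] f'.
  by apply: measurableT_comp => //; exact: measurable_oppv.
have f'_ge0 x : 0 <= f' x by exact: f_ge0.
have mEf := (measurable_EFinP _ _).2 mf.
have mEf' := (measurable_EFinP _ _).2 mf'.
have E : (\int[distribution P Y]_x (f x)%:E = \int[distribution P Y]_x (f' x)%:E)%E.
  rewrite ME// ME//; last by rewrite /f' oppr0.
  rewrite -ge0_integral_lebesgue_rVN//.
  - by apply: eq_integral => x _; rewrite MN.
  - by apply: emeasurable_funM => //; apply/measurable_EFinP.
  - by move=> x; rewrite -EFinM lee_fin mulr_ge0.
rewrite expectation.unlock integralE.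
rewrite (_ : (\int[P]_w _ ^\+ w)%E = (\int[distribution P Y]_x (f x)%:E)%E).
  rewrite (_ : (\int[P]_w _ ^\- w)%E = (\int[distribution P Y]_x (f' x)%:E)%E).
    by rewrite E; case: (\int[_]_x _)%E => //= r; rewrite subrr.
  rewrite ge0_integral_law//; apply: eq_integral => w _.
  by rewrite /f' /f/= funenegE dotvNr sinN -EFinN -EFin_max.
rewrite ge0_integral_law//; apply: eq_integral => w _.
by rewrite /f/= funeposE -EFin_max.
Qed.

(** The argument [t * b] sweeps a half-line, hence meets [pi / 2] up to sign. *)
Lemma sin_mul_eq0 (b : R) : (forall t, 0 < t -> sin (t * b) = 0) -> b = 0.
Proof.
move=> H; apply/eqP; apply: contraT => b0.
have nb : 0 < `|b| by rewrite normr_gt0.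
have := H (pi / 2 / `|b|) (divr_gt0 (divr_gt0 (pi_gt0 R) (ltr0n _ 2)) nb).
have [bp|bn] := ltP 0 b.
  by rewrite gtr0_norm// divfK// sin_pihalf => /eqP; rewrite oner_eq0.
rewrite ler0_norm// invrN mulrN mulNr divfK// sinN sin_pihalf => /eqP.
by rewrite oppr_eq0 oner_eq0.
Qed.

Lemma cexp_opp_mul t (a b : R) : cexp (- (t%:C%C * Complex a b)) =
  Complex (expR (- (t * a)) * cos (t * b)) (- (expR (- (t * a)) * sin (t * b))).
Proof.
by rewrite /cexp; congr Complex; rewrite ?mul0r ?subr0 ?addr0 ?cosN ?sinN ?mulrN.
Qed.

Lemma im_exponent_eq0 xi : complex.Im (psi xi) = 0.
Proof.
apply: sin_mul_eq0 => t t0.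
have := X_psi xi (ltW t0); rewrite /char_fun (expectation_sin_eq0 _ (X_unimodal t0)).
case: (psi xi) => a b; rewrite cexp_opp_mul => -[_] /esym/eqP.
by rewrite oppr_eq0 mulf_eq0 gt_eqF ?expR_gt0//= => /eqP.
Qed.

Lemma integral_cos t xi : 0 <= t ->
  (\int[P]_w (cos (dotv xi (X t w)))%:E = (expR (- (t * re_exponent xi)))%:E)%E.
Proof.
move=> t0; have := X_psi xi t0; rewrite /char_fun /re_exponent.
have := im_exponent_eq0 xi; case: (psi xi) => a b.
rewrite /complex.Im /complex.Re => ->; rewrite cexp_opp_mul mulr0 cos0 mulr1 => -[<- _].
rewrite expectation.unlock fineK//.
by apply: integrable_fin_num => //; exact: integrable_cos_RV.
Qed.

Lemma integral_one_sub_cos t xi : 0 <= t ->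
  (\int[P]_w (one_sub_cos xi (X t w))%:E =
   (1 - expR (- (t * re_exponent xi)))%:E)%E.
Proof.
move=> t0; under eq_integral do rewrite EFinB.
have Ic := integrable_cos_RV (X t) xi.
have I1 : P.-integrable setT (fun=> 1%:E) by exact: finite_measure_integrable_cst.
rewrite integralB// integral_cos// integral_cst//.
by rewrite mul1e EFinB; congr (_ - _)%E; exact: probability_setT.
Qed.

Lemma re_exponent_ge0 xi : 0 <= re_exponent xi.
Proof.
have : (0 <= (1 - expR (- (1 * re_exponent xi)))%:E)%E.
  rewrite -integral_one_sub_cos//; apply: integral_ge0 => w _.
  by rewrite lee_fin one_sub_cos_ge0.
by rewrite mul1r lee_fin subr_ge0 expR_le1 oppr_le0.
Qed.

Lemma integral_truncated_square_RV_le t eta : 0 < t ->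
  (\int[P]_w (truncated_square eta (X t w))%:E <=
   (radial_const (R := R) (d := d) * (1 - expR (- (t * re_exponent eta))))%:E)%E.
Proof.
move=> t0.
have := isotropic_unimodal_truncated_square_le d0 eta (X_unimodal t0).
rewrite (ge0_integral_law _ (measurable_truncated_square eta))//; last first.
move=> x; exact: truncated_square_ge0.
rewrite (ge0_integral_law _ (measurable_one_sub_cos eta))//; last first.
  by move=> x; exact: one_sub_cos_ge0.
rewrite integral_one_sub_cos; last exact: ltW.
by rewrite -EFinM.
Qed.

Definition exponent_const : R := 2 * d%:R ^+ 2 * radial_const (R := R) (d := d).

(** From [1 - cos u <= min(2, u ^ 2 / 2)] and the Cauchy-Schwarz inequality, used
    in the crude form [|<x, y>| <= d * |x| * |y|]. *)
Lemma one_sub_cos_le_truncated_square zeta eta x : eta != 0 ->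
  one_sub_cos zeta x <= 2 * d%:R ^+ 2 *
    Num.max 1 ((enorm zeta / enorm eta) ^+ 2) * truncated_square eta x.
Proof.
move=> eta0; rewrite /truncated_square; set q := _ / _.
have e0 : 0 < enorm eta by rewrite enorm_gt0.
have D1 : 1 <= d%:R ^+ 2 :> R by rewrite exprn_ege1// dR_ge1.
have m1 : 1 <= Num.max 1 (q ^+ 2) by rewrite le_max lexx.
have mq : q ^+ 2 <= Num.max 1 (q ^+ 2) by rewrite le_max lexx orbT.
case: (leP 1 ((enorm eta * enorm x) ^+ 2)) => [H|H].
  rewrite mulr1.
  have : one_sub_cos zeta x <= 2 by have := cos_geN1 (dotv zeta x); rewrite /one_sub_cos; lra.
  by move/le_trans; apply; rewrite -mulrA ler_peMr// mulr_ege1.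
have S : (dotv zeta x) ^+ 2 <= d%:R ^+ 2 * (q ^+ 2 * (enorm eta * enorm x) ^+ 2).
  rewrite -!exprMn (_ : q * _ = enorm zeta * enorm x); last first.
    by rewrite mulrA divfK// gt_eqF.
  apply: sqr_le_norm; rewrite (le_trans (norm_dotv_le _ _))//.
  exact: ler_norm.
have Hz := one_sub_cos_le (dotv zeta x).
have S2 : q ^+ 2 * (enorm eta * enorm x) ^+ 2 <=
    Num.max 1 (q ^+ 2) * (enorm eta * enorm x) ^+ 2.
  by rewrite ler_wpM2r// sqr_ge0.
have dz := le_trans S (ler_wpM2l (sqr_ge0 d%:R) S2).
have z0 : 0 <= d%:R ^+ 2 * (Num.max 1 (q ^+ 2) * (enorm eta * enorm x) ^+ 2).
  exact: mulr_ge0 (sqr_ge0 _) (mulr_ge0 (le_trans ler01 m1) (sqr_ge0 _)).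
rewrite [leRHS](_ : _ = 2 * (d%:R ^+ 2 *
  (Num.max 1 (q ^+ 2) * (enorm eta * enorm x) ^+ 2))); last by ring.
by rewrite /one_sub_cos; lra.
Qed.

(** Division by [t] and [t -> 0], made quantitative. *)
Lemma le_of_one_sub_expR (a b C : R) : 0 <= a -> 0 <= C -> 0 <= b ->
  (forall t, 0 < t -> 1 - expR (- (t * a)) <= C * (1 - expR (- (t * b)))) ->
  a <= C * b.
Proof.
move=> a0 C0 b0 H; apply/ler_addgt0Pr => e e0.
pose t := e / (C * b * a + 1).
have D0 : 0 < C * b * a + 1 by rewrite ltr_wpDl// !mulr_ge0.
have t0 : 0 < t by rewrite divr_gt0.
have := H t t0.
(* [a t / (1 + a t) <= 1 - exp (- a t)] and [1 - exp (- b t) <= b t] *)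
have h1 : 1 - expR (- (t * b)) <= t * b.
  by have := expR_ge1Dx (- (t * b)); lra.
have ta0 : 0 <= t * a by rewrite mulr_ge0// ltW.
have h2 : t * a <= (1 - expR (- (t * a))) * (1 + t * a).
  have e1 : expR (- (t * a)) * (1 + t * a) <= 1.
    by rewrite expRN ler_pdivrMl ?expR_gt0// mulr1 expR_ge1Dx.
  lra.
move=> h3.
have h4 : t * a <= C * (t * b) * (1 + t * a).
  apply: (le_trans h2); rewrite ler_wpM2r//; first by lra.
  by apply: (le_trans h3); rewrite ler_wpM2l.
have h5 : a <= C * b + C * b * a * t.
  by rewrite -(ler_pM2l t0); lra.
apply: (le_trans h5); rewrite lerD2l /t.
rewrite mulrCA ler_piMr ?(ltW e0)// ler_pdivrMr// mul1r; lra.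
Qed.

(** The test functions at the frequencies [zeta] and [eta] are compared under the
    law of [X t], and [t] tends to [0]. This single inequality expresses the
    radial symmetry (up to a constant), the almost monotonicity and the at most
    quadratic growth of [psi]. *)
Lemma re_exponent_le zeta eta : eta != 0 ->
  re_exponent zeta <=
  exponent_const * Num.max 1 ((enorm zeta / enorm eta) ^+ 2) * re_exponent eta.
Proof.
move=> eta0; set mx := Num.max _ _.
have mx0 : 0 <= mx by rewrite le_max ler01.
have C0 : 0 <= 2 * d%:R ^+ 2 * mx :> R by rewrite !mulr_ge0.
have K0 : 0 <= radial_const (R := R) (d := d) by exact/ltW/radial_const_gt0.
apply: le_of_one_sub_expR.
- exact: re_exponent_ge0.
- by rewrite /exponent_const !mulr_ge0.
- exact: re_exponent_ge0.
move=> t t0; rewrite -lee_fin -integral_one_sub_cos; last exact: ltW.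
apply: (@le_trans _ _ (\int[P]_w ((2 * d%:R ^+ 2 * mx)%:E * (truncated_square eta (X t w))%:E))%E).
  apply: le_integral_patch => [w _|w _|w].
  - by rewrite lee_fin one_sub_cos_ge0.
  - by rewrite mule_ge0// lee_fin// truncated_square_ge0.
  by rewrite !patch_setT -EFinM lee_fin one_sub_cos_le_truncated_square.
rewrite ge0_integralZl//; last 2 first.
- apply/measurable_EFinP; apply: measurableT_comp => //.
  exact: measurable_truncated_square.
- by move=> w _; rewrite lee_fin truncated_square_ge0.
apply: (le_trans (lee_wpmul2l _ (integral_truncated_square_RV_le eta t0))).
  by rewrite lee_fin.
by rewrite -EFinM lee_fin /exponent_const; rewrite le_eqVlt; apply/orP; left; apply/eqP; ring.
Qed.

End exponent.

(** * The potential measure as a time integral *)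

Section potential.
Context {R : realType} {d : nat} {disp : measure_display}.
Context {Omega : measurableType disp} {P : probability Omega R}.
Variable X : R -> {RV P >-> 'rV[R]_d}.

Local Notation leb := (@lebesgue_measure R).

(** A point of the grid [n.+1^-1 * nat] strictly to the right of [t], because the
    paths are only right-continuous. *)
Definition right_grid (n : nat) (t : R) : R :=
  (Num.truncn (t * n.+1%:R)).+1%:R / n.+1%:R.

Lemma right_grid_gt n t : t < right_grid n t.
Proof. by rewrite ltr_pdivlMr ?ltr0n// truncnS_gt. Qed.

Lemma right_grid_le n t : 0 <= t -> right_grid n t <= t + n.+1%:R^-1.
Proof.
move=> t0; rewrite /right_grid ler_pdivrMr ?ltr0n// mulrDl mulVf ?pnatr_eq0//.
by rewrite -natr1 lerD2r truncn_le mulr_ge0.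
Qed.

Lemma cvg_right_grid t : 0 <= t -> right_grid n t @[n --> \oo] --> t.
Proof.
move=> t0; apply: (@squeeze_cvgr _ _ _ _ (fun=> t) (fun n => t + n.+1%:R^-1)).
- by near=> n; rewrite right_grid_le// ltW ?right_grid_gt.
- exact: cvg_cst.
- rewrite -[X in _ --> X]addr0; apply: cvgD; first exact: cvg_cst.
  exact: cvg_harmonic.
Unshelve. all: by end_near. Qed.

Lemma measurable_right_grid n :
  measurable_fun [set: measurableTypeR R * Omega]
    (fun p => X (right_grid n p.1) p.2).
Proof.
move=> _ B mB; rewrite setTI.
rewrite (_ : _ @^-1` B = \bigcup_k
    ([set t : R | Num.truncn (t * n.+1%:R) = k] `*`
     (X (k.+1%:R / n.+1%:R) @^-1` B))).
  apply: bigcupT_measurable => k; apply: measurableX.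
    apply: is_interval_measurable => s t /= sk tk u /andP[su ut].
    apply/eqP; rewrite eqn_leq -{1}tk -sk !le_truncn//.
    - by rewrite ler_wpM2r.
    - by rewrite ler_wpM2r.
  by rewrite -[X in measurable X]setTI; exact: measurable_funPT.
apply/seteqP; split=> [[t w] /= Bw|[t w] /= [k _ [/= <-]]//].
by exists (Num.truncn (t * n.+1%:R)).
Qed.

Hypothesis X_cadlag : {ae P, forall w, cadlag (X ^~ w)}.

(** Right-continuous paths are limits of their values on the grids above; the
    exceptional null set is removed because the path is arbitrary there. *)
Lemma measurable_cadlag_process : exists N : set Omega,
  [/\ measurable N, P N = 0%E, forall w, ~ N w -> cadlag (X ^~ w) &
   measurable_fun ((`[0, +oo[ : set (measurableTypeR R)) `*` ~` N)
     (fun p => X p.1 p.2)].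
Proof.
have [N [mN PN subN]] := X_cadlag.
have cadN w : ~ N w -> cadlag (X ^~ w).
  by move=> Nw; apply: contrapT => ncad; apply: Nw; exact: subN.
exists N; split => //.
set D := _ `*` _.
have mD : measurable D by apply: measurableX => //; exact: measurableC.
pose h n (p : measurableTypeR R * Omega) := X (right_grid n p.1) p.2.
suff coordX i : measurable_fun D (fun p => X p.1 p.2 ord0 i).
  move=> _ Y mY.
  pose X' (p : measurableTypeR R * Omega) : 'rV[R]_d :=
    \row_i ((fun p => X p.1 p.2 ord0 i) \_ D) p.
  have mX' : measurable_fun setT X'.
    apply/measurable_fun_rVP => i; under eq_fun do rewrite mxE.
    exact/(measurable_restrictT _ _).1.
  rewrite (_ : _ `&` _ = D `&` (setT `&` X' @^-1` Y)).
    by apply: measurableI => //; exact: mX'.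
  rewrite setTI; apply/seteqP; split=> p [Dp Yp]; split => //=.
    rewrite (_ : X' p = X p.1 p.2)//; apply/rowP => i.
    by rewrite mxE patchE mem_set.
  move: Yp; rewrite /= (_ : X' p = X p.1 p.2)//; apply/rowP => i.
  by rewrite mxE patchE mem_set.
apply: (@measurable_fun_cvg _ _ _ _ (fun n p => h n p ord0 i)).
  move=> n; apply: measurable_funTS.
  apply: (measurableT_comp (measurable_rV_coord i)).
  exact: measurable_right_grid.
move=> [t w] [/= t0 Nw]; rewrite in_itv/= andbT in t0.
have [rc _] := cadN w Nw.
have ci : (fun s => X s w ord0 i) s @[s --> t^'+] --> X t w ord0 i.
  apply: (@cvg_comp _ _ _ (X ^~ w) (fun x : 'rV[R]_d => x ord0 i)); last exact: coord_continuous.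
  exact: rc.
move/cvg_at_rightP: ci; apply; split; last exact: cvg_right_grid.
by move=> n; exact: right_grid_gt.
Qed.

(** A possibly non-measurable [f] is squeezed between modifications of [g] on the
    null set, with the values [0] and [+oo] there. *)
Lemma integral_off_null_set (N : set Omega) (f g : Omega -> \bar R) :
  measurable N -> P N = 0%E -> measurable_fun setT g ->
  (forall w, 0 <= f w)%E -> (forall w, 0 <= g w)%E ->
  (forall w, ~ N w -> f w = g w) ->
  (\int[P]_w f w = \int[P]_w g w)%E.
Proof.
move=> mN PN mg f0 g0 fg.
have mtb (c : \bar R) : measurable_fun setT (fun w => if w \in N then c else g w).
  apply: measurable_fun_ifT => //.
  apply: (@measurable_fun_bool _ _ _ _ true).
  by rewrite setTI (_ : _ @^-1` _ = N)//; apply/seteqP; split=> w /=; [exact: set_mem|exact: mem_set].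
have aeN (c : \bar R) : ae_eq P setT g (fun w => if w \in N then c else g w).
  exists N; split => // w /= ; apply: contra_notP => Nw _.
  by rewrite memNset.
have gE (c : \bar R) : (0 <= c)%E ->
    (\int[P]_w g w = \int[P]_w (if w \in N then c else g w))%E.
  move=> c0; apply: ge0_ae_eq_integral => //.
  by move=> w _; case: ifPn.
apply/eqP; rewrite eq_le; apply/andP; split.
  rewrite (gE +oo%E) ?leey//; apply: le_integral_patch => // w.
    by move=> _; case: ifPn => // _; exact: leey.
  rewrite !patch_setT; case: ifPn => [_|/negP Nw]; first exact: leey.
  by rewrite fg// => /mem_set.
rewrite (gE 0%E)//; apply: le_integral_patch => // w.
  by move=> _; case: ifPn.
rewrite !patch_setT; case: ifPn => [_//|/negP Nw].
by rewrite fg// => /mem_set.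
Qed.

(** Tonelli's theorem, off the null set of irregular paths. *)
Lemma potentialE (A : set 'rV[R]_d) : measurable A ->
  potential X A =
  (\int[leb]_(t in `[0%R, +oo[) P [set w | A (X t w)])%E.
Proof.
move=> mA; have [N [mN PN _ mX]] := measurable_cadlag_process.
set D := _ `*` _ in mX.
have mD : measurable D by apply: measurableX => //; exact: measurableC.
pose A' := D `&` (fun p : measurableTypeR R * Omega => X p.1 p.2) @^-1` A.
have mA' : measurable A' by exact: mX.
pose g (p : measurableTypeR R * Omega) : \bar R := (\1_A' p)%:E.
have mg : measurable_fun setT g by apply/measurable_EFinP; exact: measurable_indic.
have g0 p : (0 <= g p)%E by rewrite lee_fin.
transitivity (\int[P]_w \int[leb]_t g (t, w))%E.
  apply: (integral_off_null_set mN PN).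
  - exact: (@measurable_fun_fubini_tonelli_G _ _ _ _ _ leb g mg g0).
  - by move=> w; apply: integral_ge0 => t _; rewrite lee_fin.
  - by move=> w; exact: integral_ge0.
  move=> w Nw; rewrite integral_mkcond; apply: eq_integral => t _.
  rewrite patchE /g !indicE; case: ifPn => [/set_mem t0|].
    congr ((_%:R)%:E); congr nat_of_bool.
    apply/idP/idP => /set_mem H; apply/mem_set; last by case: H.
    by split.
  by rewrite notin_setE => t0; rewrite memNset// => -[[]].
rewrite -(fubini_tonelli g)// [RHS]integral_mkcond; apply: eq_integral => t _.
rewrite patchE; case: ifPn => [/set_mem t0|].
  transitivity (\int[P]_w (\1_(~` N `&` X t @^-1` A) w)%:E)%E.
    apply: eq_integral => w _; rewrite /g !indicE; congr ((_%:R)%:E).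
    congr nat_of_bool; apply/idP/idP => /set_mem H; apply/mem_set.
      by case: H => [[? ?] ?]; split.
    by case: H => ? ?; split.
  have mXA : measurable (X t @^-1` A).
    by rewrite -[X in measurable X]setTI; exact: measurable_funPT.
  rewrite integral_indic//; last by apply: measurableI => //; exact: measurableC.
  rewrite setIT setIC -setDE measureD//; last by rewrite (le_lt_trans (probability_le1 _ _))// ltry.
  rewrite [X in (_ - X)%E](_ : _ = 0%E) ?sube0//.
  apply/eqP; rewrite eq_le measure_ge0 andbT -PN.
  by apply: le_measure => //; rewrite inE//; exact: measurableI.
rewrite notin_setE => t0; apply: integral0_eq => w _.
by rewrite /g indicE memNset// => -[[]].
Qed.

End potential.

(** * Two-sided bounds on the potential of balls *)

Section fejer_weights.
Context {R : realType}.

Definition geom_weight (a b : nat) : R := 2^-1 ^+ ((a - b) + (b - a)).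

Lemma geom_weight_ge0 a b : 0 <= geom_weight a b.
Proof. by rewrite exprn_ge0. Qed.

(** The bound is reinforced by the exact growth of the partial sums, before and
    after the peak at [b = a]. *)
Lemma sum_geom_weight_le (a N : nat) : \sum_(b < N) geom_weight a b <= 3.
Proof.
suff : \sum_(b < N) geom_weight a b <=
    if (N <= a)%N then 2^-1 ^+ (a - N) else 3 - 2 * 2^-1 ^+ (N - a).
  move/le_trans; apply; case: ifPn => _.
    by apply: (@le_trans _ _ 1); [apply: exprn_ile1; lra|lra].
  by rewrite gerBl mulr_ge0// exprn_ge0.
elim: N => [|N IHN]; first by rewrite big_ord0 leq0n exprn_ge0.
rewrite big_ord_recr/= (le_trans (lerD IHN (lexx _)))// /geom_weight.
case: (ltngtP N a) => [Na|aN|<-].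
- rewrite (_ : (N - a = 0)%N) ?addn0; last by apply/eqP; rewrite subn_eq0 ltnW.
  by rewrite -(subnSK Na) exprS; lra.
- rewrite (_ : (a - N = 0)%N) ?add0n; last by apply/eqP; rewrite subn_eq0 ltnW.
  by rewrite subSn ?(ltnW aN)// exprS; lra.
- by rewrite subnn subSnn expr0 expr1; lra.
Qed.

Lemma expRN_sqr_dist_le (a b : nat) :
  expR (- (a%:R - b%:R) ^+ 2) <= geom_weight a b :> R.
Proof.
have e2 : 2 <= expR 1 :> R by have := expR_ge1Dx (1 : R); lra.
have H (n : nat) : expR (- (n%:R ^+ 2)) <= 2^-1 ^+ n :> R.
  rewrite (@le_trans _ _ (expR (- n%:R)))//.
    rewrite ler_expR lerN2 -natrX ler_nat.
    by case: n => // n; rewrite expnS expn1 leq_pmulr.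
  rewrite expRN exprVn lef_pV2 ?posrE ?expR_gt0 ?exprn_gt0//.
  by rewrite -[n%:R]mulr1 expRM_natl lerXn2r// nnegrE ?expR_ge0.
rewrite /geom_weight; have [ab|ba] := leqP a b.
  rewrite (_ : (a - b = 0)%N) ?add0n; last by apply/eqP; rewrite subn_eq0.
  by rewrite -sqrrN opprB -natrB.
rewrite (_ : (b - a = 0)%N) ?addn0; last by apply/eqP; rewrite subn_eq0 ltnW.
by rewrite -natrB// ltnW.
Qed.

(** For fixed [j] the sum over [k] factorizes into [d] one-dimensional sums. *)
Lemma sum_prod_geom_weight_le (d N : nat) :
  \sum_(j : {ffun 'I_d -> 'I_N}) \sum_(k : {ffun 'I_d -> 'I_N})
     \prod_i geom_weight (j i) (k i) <= (3 * N%:R) ^+ d.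
Proof.
rewrite (@le_trans _ _ (\sum_(j : {ffun 'I_d -> 'I_N}) 3 ^+ d))//.
  apply: ler_sum => j _.
  rewrite -(bigA_distr_bigA (fun i (b : 'I_N) => geom_weight (j i) b)).
  rewrite -[in leRHS](card_ord d) -prodr_const; apply: ler_prod => i _.
  by rewrite sumr_ge0 => [|b _]; [exact: sum_geom_weight_le|exact: geom_weight_ge0].
by rewrite sumr_const card_ffun !card_ord exprMn -[N%:R ^+ d]natrX mulr_natr.
Qed.

(** The positivity of the Fejer kernel: the left-hand side is the square of the
    real part of an exponential sum, the right-hand side its squared modulus. *)
Lemma sqr_sum_cos_le (I : finType) (f : I -> R) :
  (\sum_j cos (f j)) ^+ 2 <= \sum_j \sum_k cos (f j - f k).
Proof.
have -> : \sum_j \sum_k cos (f j - f k) =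
    (\sum_j cos (f j)) ^+ 2 + (\sum_j sin (f j)) ^+ 2.
  rewrite !expr2 !big_distrlr/= -big_split; apply: eq_bigr => j _ /=.
  by rewrite -big_split; apply: eq_bigr => k _ /=; rewrite cosB.
by rewrite lerDl sqr_ge0.
Qed.

End fejer_weights.

Section potential_bounds.
Context {R : realType} {d : nat} {disp : measure_display}.
Context {Omega : measurableType disp} {P : probability Omega R}.
Variable X : R -> {RV P >-> 'rV[R]_d}.
Variable psi : 'rV[R]_d -> R[i].
Hypothesis d3 : (3 <= d)%N.
Hypothesis X_levy : levy_process X.
Hypothesis X_unimodal : isotropic_unimodal_process X.
Hypothesis X_psi : char_exponent X psi.

Local Notation leb := (@lebesgue_measure R).
Local Notation p := (re_exponent psi).
Local Notation K := (radial_const (R := R) (d := d)).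
Local Notation Cp := (exponent_const (R := R) (d := d)).

Let d0 : (0 < d)%N. Proof. exact: leq_trans d3. Qed.

Lemma measurable_RV_preimage t (A : set 'rV[R]_d) : measurable A ->
  measurable [set w | A (X t w)].
Proof.
by move=> mA; rewrite -[X in measurable X]setTI; exact: measurable_funPT.
Qed.

Lemma exponent_const_gt0 : 0 < Cp.
Proof.
rewrite /exponent_const mulr_gt0//; last exact: radial_const_gt0.
by rewrite mulr_gt0// exprn_gt0// ltr0n.
Qed.

(** Markov's inequality: [truncated_square eta] is [1] outside the ball, and its
    mean is at most [K * (1 - exp (- t * p eta))]. *)
Lemma probability_ball_ge eta t : eta != 0 -> 0 < t -> t * p eta <= (2 * K)^-1 ->
  ((2^-1)%:E <= P [set w | closed_eball (enorm eta)^-1 (X t w)])%E.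
Proof.
move=> eta0 t0 tp; have e0 : 0 < enorm eta by rewrite enorm_gt0.
have K0 : 0 < K := radial_const_gt0 d0.
set B := [set w | _].
have mB : measurable B by apply: measurable_RV_preimage; exact: measurable_eball.
have PC : (P (~` B) <= (2^-1)%:E)%E.
  apply: (@le_trans _ _ (\int[P]_w (truncated_square eta (X t w))%:E)%E).
    rewrite -[P _]mul1e -integral_cst; last exact: measurableC.
    apply: le_integral_patch => [//|w _|w].
      by rewrite lee_fin truncated_square_ge0.
    rewrite patch_setT patchE; case: ifPn => [/set_mem|_]; last first.
      by rewrite lee_fin truncated_square_ge0.
    rewrite /B/= => /negP; rewrite -ltNge => xr.
    rewrite lee_fin /truncated_square le_min lexx/= exprn_ege1// mulrC.
    by rewrite -ler_pdivrMr// mul1r ltW.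
  have := integral_truncated_square_RV_le d0 X_unimodal X_psi eta t0.
  move/le_trans; apply; rewrite lee_fin.
  have : 1 - expR (- (t * p eta)) <= t * p eta.
    by have := expR_ge1Dx (- (t * p eta)); lra.
  move/(fun h => le_trans h tp) => /(ler_wpM2l (ltW K0))/le_trans; apply.
  by rewrite invfM mulrCA divff ?gt_eqF// mulr1.
have PB : (P B = 1 - P (~` B))%E by rewrite -probability_setC ?setCK//; exact: measurableC.
rewrite PB leeBrDr ?fin_num_measure//; last exact: measurableC.
apply: (le_trans (leeD2l _ PC)); rewrite -EFinD lee_fin; lra.
Qed.

Lemma potential_ball_ge eta : eta != 0 -> 0 < p eta ->
  ((4 * K * p eta)^-1%:E <= potential X (closed_eball (enorm eta)^-1))%E.
Proof.
move=> eta0 p0; have K0 : 0 < K := radial_const_gt0 d0.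
rewrite (potentialE (levy_cadlag X_levy)); last exact: measurable_eball.
pose T := (2 * K * p eta)^-1.
have T0 : 0 < T by rewrite invr_gt0 mulr_gt0// mulr_gt0.
apply: (@le_trans _ _ (\int[leb]_(t in `]0%R, T]) (2^-1)%:E)%E).
  rewrite integral_cst//= lebesgue_measure_itv/= lte_fin T0 oppr0 adde0 -EFinM.
  rewrite lee_fin /T -invfM le_eqVlt; apply/orP; left; apply/eqP.
  by congr (_^-1); ring.
apply: le_integral_patch => [//|//|t].
rewrite !patchE; case: ifPn => [/set_mem|_]; last first.
  by case: ifPn => // _; exact: measure_ge0.
rewrite /= in_itv/= => /andP[t0 tT]; rewrite ifT; last first.
  by apply/mem_set; rewrite /= in_itv/= ltW.
apply: probability_ball_ge => //.
rewrite -ler_pdivlMr// (le_trans tT)// /T invfM.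
by rewrite le_refl.
Qed.

End potential_bounds.

Section potential_upper_bound.
Context {R : realType} {d : nat} {disp : measure_display}.
Context {Omega : measurableType disp} {P : probability Omega R}.
Variable X : R -> {RV P >-> 'rV[R]_d}.
Variable psi : 'rV[R]_d -> R[i].
Hypothesis d3 : (3 <= d)%N.
Hypothesis X_levy : levy_process X.
Hypothesis X_unimodal : isotropic_unimodal_process X.
Hypothesis X_psi : char_exponent X psi.

Local Notation leb := (@lebesgue_measure R).
Local Notation p := (re_exponent psi).
Local Notation Cp := (exponent_const (R := R) (d := d)).

Let d0 : (0 < d)%N. Proof. exact: leq_trans d3. Qed.

(** Up to a constant the inverse of the exponent at [eta]; the grid points used at
    time [N ^ 2 * time_scale eta] then have characteristic functions bounded by
    integer Gaussian weights. *)
Definition time_scale eta : R := Cp * d%:R ^+ 4 / p eta.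

Definition grid_step (eta : 'rV[R]_d) (N : nat) : R :=
  enorm eta / (d%:R ^+ 2 * N%:R).

(** The frequencies of the exponential sum: a grid of mesh [grid_step] filling
    a cube in the ball of radius [|eta|]. *)
Definition grid_point eta N (j : {ffun 'I_d -> 'I_N}) : 'rV[R]_d :=
  \row_i (grid_step eta N * (j i)%:R).

Lemma dR_gt0 : 0 < d%:R :> R. Proof. by rewrite ltr0n. Qed.

Lemma grid_step_gt0 eta N : eta != 0 -> (0 < N)%N -> 0 < grid_step eta N.
Proof.
move=> eta0 N0.
by rewrite divr_gt0 ?enorm_gt0// mulr_gt0 ?ltr0n// exprn_gt0// dR_gt0.
Qed.

Lemma grid_stepE eta N : (0 < N)%N ->
  enorm eta = d%:R ^+ 2 * N%:R * grid_step eta N.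
Proof.
move=> N0; rewrite /grid_step mulrC divfK// mulf_neq0 ?pnatr_eq0 -?lt0n//.
by rewrite expf_neq0// gt_eqF// dR_gt0.
Qed.

Lemma enorm_grid_point_le eta N (j : {ffun 'I_d -> 'I_N}) :
  eta != 0 -> (0 < N)%N ->
  enorm (grid_point eta j) <= d%:R * (grid_step eta N * N%:R).
Proof.
move=> eta0 N0; apply: enorm_le_dim => i.
have h0 := ltW (grid_step_gt0 eta0 N0).
by rewrite mxE normrM (ger0_norm h0) ger0_norm// ler_wpM2l// ler_nat ltnW.
Qed.

(** [re_exponent_le] read backwards: within the ball of radius [|eta|] the
    exponent is at least quadratic, [p z >= c * p eta * (|z| / |eta|) ^ 2]. *)
Lemma exponent_grid_ge eta N (j k : {ffun 'I_d -> 'I_N}) t :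
  eta != 0 -> 0 < p eta -> (0 < N)%N -> N%:R ^+ 2 * time_scale eta <= t ->
  \sum_i ((j i)%:R - (k i)%:R) ^+ 2 <=
  t * p (grid_point eta j - grid_point eta k).
Proof.
move=> eta0 p0 N0 tN; set z := _ - _; set h := grid_step eta N.
have h0 : 0 < h := grid_step_gt0 eta0 N0.
have Cp0 : 0 < Cp := exponent_const_gt0 d3.
have D0 := dR_gt0; have e0 : 0 < enorm eta by rewrite enorm_gt0.
have NR0 : 0 < N%:R :> R by rewrite ltr0n.
have T0 : 0 < time_scale eta by rewrite divr_gt0// mulr_gt0// exprn_gt0.
have zE : \sum_i ((j i)%:R - (k i)%:R) ^+ 2 = enorm z ^+ 2 / h ^+ 2.
  rewrite sqr_enorm /dotv mulr_suml; apply: eq_bigr => i _.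
  by rewrite !mxE -/h -mulrBr; field; rewrite gt_eqF.
have t0 : 0 <= t by apply: le_trans tN; rewrite mulr_ge0 ?exprn_ge0// ltW.
have [z0|z0] := eqVneq z 0.
  rewrite zE z0 enorm0 expr0n/= mul0r mulr_ge0//.
  exact: (re_exponent_ge0 X_unimodal X_psi).
have ez0 : 0 < enorm z by rewrite enorm_gt0.
have ze : enorm z <= enorm eta.
  apply: (@le_trans _ _ (d%:R * (h * N%:R))).
    apply: enorm_le_dim => i; rewrite !mxE -/h -mulrBr normrM (gtr0_norm h0).
    rewrite ler_wpM2l ?(ltW h0)// ler_norml.
    have := ltn_ord (j i); have := ltn_ord (k i); rewrite -!(ltr_nat R).
    have := ler0n R (j i); have := ler0n R (k i) => *; apply/andP; split; lra.
  rewrite (grid_stepE eta N0) -/h [leRHS](_ : _ = d%:R * (d%:R * (h * N%:R))).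
    rewrite ler_pM2l//; apply: ler_peMl; last by rewrite ler1n.
    by rewrite mulr_ge0// ltW.
  by ring.
have := re_exponent_le d0 X_unimodal X_psi eta z0.
rewrite (max_idPr _); last first.
  by rewrite exprn_ege1// ler_pdivlMr// mul1r.
rewrite expr_div_n => key.
rewrite zE.
have pz0 : 0 <= p z := re_exponent_ge0 X_unimodal X_psi z.
apply: (le_trans _ (ler_wpM2r pz0 tN)).
rewrite /time_scale ler_pdivrMr ?exprn_gt0//.
have hE := grid_stepE eta N0.
have key2 : p eta * enorm z ^+ 2 <= Cp * enorm eta ^+ 2 * p z.
  have ez2 : 0 < enorm z ^+ 2 by rewrite exprn_gt0.
  have := ler_wpM2r (ltW ez2) key.
  by congr (_ <= _); field; rewrite gt_eqF.
rewrite -(ler_pM2l p0) (le_trans key2)// hE -/h le_eqVlt; apply/orP; left.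
by apply/eqP; field; rewrite gt_eqF.
Qed.

Lemma integral_cos_grid_le eta N (j k : {ffun 'I_d -> 'I_N}) t :
  eta != 0 -> 0 < p eta -> (0 < N)%N -> N%:R ^+ 2 * time_scale eta <= t -> 0 <= t ->
  (\int[P]_w (cos (dotv (grid_point eta j - grid_point eta k) (X t w)))%:E <=
   (\prod_i geom_weight (R := R) (j i) (k i))%:E)%E.
Proof.
move=> eta0 p0 N0 tN t0; rewrite (integral_cos X_unimodal X_psi)// lee_fin.
apply: (@le_trans _ _ (expR (\sum_i - ((j i)%:R - (k i)%:R) ^+ 2))).
  by rewrite ler_expR sumrN lerN2; exact: exponent_grid_ge.
rewrite expR_sum; apply: ler_prod => i _.
by rewrite expR_ge0 expRN_sqr_dist_le.
Qed.

Lemma sum_cos_grid_ge eta N x : eta != 0 -> (0 < N)%N ->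
  enorm x <= (enorm eta)^-1 ->
  N%:R ^+ d / 2 <= \sum_(j : {ffun 'I_d -> 'I_N}) cos (dotv (grid_point eta j) x).
Proof.
move=> eta0 N0 xe.
have e0 : 0 < enorm eta by rewrite enorm_gt0.
have h0 := grid_step_gt0 eta0 N0.
apply: (@le_trans _ _ (\sum_(j : {ffun 'I_d -> 'I_N}) (1 / 2))).
  rewrite sumr_const card_ffun !card_ord -[leRHS]mulr_natr natrX mulrC.
  by rewrite div1r.
apply: ler_sum => j _; apply: cos_ge_half.
rewrite (le_trans (norm_dotv_le _ _))//.
apply: (@le_trans _ _ (d%:R * ((d%:R * (grid_step eta N * N%:R)) * (enorm eta)^-1))).
  apply: ler_wpM2l => //; apply: ler_pM; rewrite ?enorm_ge0//.
  exact: enorm_grid_point_le.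
rewrite (grid_stepE eta N0) le_eqVlt; apply/orP; left; apply/eqP.
field; rewrite pnatr_eq0 -lt0n N0 !gt_eqF//=; exact: dR_gt0.
Qed.

(** Fejer-kernel bound: the square of the exponential sum is at least
    [N ^ (2 * d) / 4] on the ball, and its mean is at most [(3 * N) ^ d]. *)
Lemma probability_ball_le eta N t :
  eta != 0 -> 0 < p eta -> (0 < N)%N -> N%:R ^+ 2 * time_scale eta <= t -> 0 <= t ->
  (P [set w | closed_eball (enorm eta)^-1 (X t w)] <=
   (4 * 3 ^+ d / N%:R ^+ d)%:E)%E.
Proof.
move=> eta0 p0 N0 tN t0; set B := [set w | _].
have mB : measurable B by apply: measurable_RV_preimage; exact: measurable_eball.
have NR0 : 0 < N%:R ^+ d :> R by rewrite exprn_gt0// ltr0n.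
pose M : R := (N%:R ^+ d / 2) ^+ 2.
have M0 : 0 < M by rewrite exprn_gt0// divr_gt0.
pose c (jk : {ffun 'I_d -> 'I_N} * {ffun 'I_d -> 'I_N}) w :=
  cos (dotv (grid_point eta jk.1 - grid_point eta jk.2) (X t w)).
have sqrc w : (\sum_j cos (dotv (grid_point eta (N := N) j) (X t w))) ^+ 2 <=
    \sum_jk c jk w.
  apply: (le_trans (sqr_sum_cos_le _)); rewrite pair_bigA/=.
  by rewrite le_eqVlt; apply/orP; left; apply/eqP/eq_bigr => jk _; rewrite /c dotvBl.
have MB : (M%:E * P B <= (3 ^+ d * N%:R ^+ d)%:E)%E.
  apply: (@le_trans _ _ (\int[P]_w (\sum_jk c jk w)%:E)%E).
    rewrite -integral_cst//; apply: le_integral_patch => [w _|w _|w].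
    - by rewrite lee_fin ltW.
    - by rewrite lee_fin; exact: le_trans (sqr_ge0 _) (sqrc w).
    rewrite patch_setT patchE; case: ifPn => [/set_mem Bw|_]; last first.
      by rewrite lee_fin; exact: le_trans (sqr_ge0 _) (sqrc w).
    rewrite lee_fin (le_trans _ (sqrc w))//; apply: sqr_le_norm.
    have S := sum_cos_grid_ge eta0 N0 Bw.
    rewrite (ger0_norm (divr_ge0 (ltW NR0) (ler0n _ 2))).
    exact: le_trans S (ler_norm _).
  under eq_integral do rewrite -sumEFin.
  rewrite integral_sum//; last first.
    move=> jk; exact: integrable_cos_RV.
  apply: (@le_trans _ _ (\sum_(jk : {ffun 'I_d -> 'I_N} * {ffun 'I_d -> 'I_N})
    (\prod_i geom_weight (R := R) (jk.1 i) (jk.2 i))%:E)%E).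
    by apply: lee_sum => jk _; exact: integral_cos_grid_le.
  rewrite sumEFin lee_fin -exprMn.
  rewrite -(pair_bigA _ (fun j k : {ffun 'I_d -> 'I_N} =>
     \prod_i geom_weight (R := R) (j i) (k i)))/=.
  exact: sum_prod_geom_weight_le.
have : (P B <= (M^-1 * (3 ^+ d * N%:R ^+ d))%:E)%E.
  by rewrite EFinM lee_pdivlMl.
move/le_trans; apply; rewrite lee_fin le_eqVlt; apply/orP; left; apply/eqP.
by rewrite /M; field; rewrite gt_eqF.
Qed.

End potential_upper_bound.

Section potential_upper_bound_integral.
Context {R : realType} {d : nat} {disp : measure_display}.
Context {Omega : measurableType disp} {P : probability Omega R}.
Variable X : R -> {RV P >-> 'rV[R]_d}.
Variable psi : 'rV[R]_d -> R[i].
Hypothesis d3 : (3 <= d)%N.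
Hypothesis X_levy : levy_process X.
Hypothesis X_unimodal : isotropic_unimodal_process X.
Hypothesis X_psi : char_exponent X psi.

Local Notation leb := (@lebesgue_measure R).
Local Notation p := (re_exponent psi).

(** The bound [probability_ball_le] weakened to the exponent [3], which is enough
    for summability: the [N]-th time interval has length of order [N]. *)
Definition decay (N : nat) : R := if N == 0 then 1 else 4 * 3 ^+ d / N%:R ^+ 3.

Lemma decay_ge0 N : 0 <= decay N.
Proof. by rewrite /decay; case: ifPn => // _; rewrite divr_ge0 ?mulr_ge0 ?exprn_ge0. Qed.

Lemma sum_decay_le n :
  \sum_(0 <= N < n) decay N * (2 * N%:R + 1) <= 1 + 24 * 3 ^+ d.
Proof.
have B0 : 0 < 3 ^+ d :> R by rewrite exprn_gt0.
suff H m : \sum_(0 <= N < m.+1) decay N * (2 * N%:R + 1) <=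
    1 + 24 * 3 ^+ d * (1 - m.+1%:R^-1).
  case: n => [|n]; first by rewrite big_geq// addr_ge0// mulr_ge0// ltW.
  apply: (le_trans (H n)); rewrite lerD2l; apply: ler_piMr.
    by rewrite mulr_ge0// ltW.
  by rewrite gerBl invr_ge0.
elim: m => [|m IHm].
  by rewrite big_nat1 /decay/= invr1; lra.
rewrite big_nat_recr//=; apply: (le_trans (lerD IHm (lexx _))).
rewrite /decay/= -[m.+2%:R]natr1; set x : R := m.+1%:R.
have x1 : 1 <= x by rewrite /x ler1n.
have x0 : 0 < x by lra.
rewrite -addrA lerD2l.
have E : 4 * 3 ^+ d / x ^+ 3 * (2 * x + 1) <= 12 * 3 ^+ d / x ^+ 2.
  rewrite [leRHS](_ : _ = 4 * 3 ^+ d / x ^+ 3 * (3 * x)); last by field; rewrite gt_eqF.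
  rewrite ler_wpM2l; first by lra.
    by rewrite divr_ge0 ?mulr_ge0 ?exprn_ge0 ?(ltW B0) ?(ltW x0).
  by lra.
rewrite (le_trans (lerD (lexx _) E))//.
have E2 : 12 / x ^+ 2 <= 24 * (x^-1 - (x + 1)^-1).
  rewrite [leRHS](_ : _ = 24 / (x * (x + 1))); last first.
    by field; rewrite !gt_eqF//; lra.
  rewrite ler_pdivrMr ?exprn_gt0// mulrAC ler_pdivlMr; last by rewrite mulr_gt0//; lra.
  by nra.
have := ler_wpM2l (ltW B0) E2.
move: (x^-1) ((x + 1)^-1) ((x ^+ 2)^-1) => u v w.
by rewrite !mulrA !mulrBr; lra.
Qed.

(** With [r = 1 / |eta|], the probability that [X t] lies in the ball of radius [r]
    decays like [t ^ (- d / 2)], which is integrable since [3 <= d]. The integral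
    is dominated by a series over the intervals on which [sqrt (t / T)] has a
    given integer part. *)
Lemma potential_ball_le eta : eta != 0 -> 0 < p eta ->
  (potential X (closed_eball (enorm eta)^-1) <=
   ((1 + 24 * 3 ^+ d) * time_scale psi eta)%:E)%E.
Proof.
move=> eta0 p0; set B := closed_eball _; set T := time_scale psi eta.
have d0 : (0 < d)%N by exact: leq_trans d3.
have T0 : 0 < T.
  by rewrite divr_gt0// mulr_gt0 ?exponent_const_gt0// exprn_gt0// ltr0n.
rewrite (potentialE (levy_cadlag X_levy)); last exact: measurable_eball.
pose I (N : nat) : set R := `[N%:R ^+ 2 * T, N.+1%:R ^+ 2 * T[%classic.
pose term (N : nat) (t : R) : \bar R := (decay N * \1_(I N) t)%:E.
have term0 N t : (0 <= term N t)%E by rewrite lee_fin mulr_ge0// decay_ge0.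
have mterm N : measurable_fun setT (term N).
  apply/measurable_EFinP; apply: measurable_funM => //.
  by apply: measurable_indic; exact: measurable_itv.
apply: (@le_trans _ _ (\int[leb]_t (\sum_(N <oo) term N t))%E).
  apply: le_integral_patch => [t _|t _|t].
  - exact: measure_ge0.
  - by apply: nneseries_ge0 => N _ _; exact: term0.
  rewrite patch_setT patchE; case: ifPn => [/set_mem|_]; last first.
    by apply: nneseries_ge0 => N _ _; exact: term0.
  rewrite /= in_itv/= andbT => t0.
  pose s := Num.sqrt (t / T); pose N := Num.truncn s.
  have tT0 : 0 <= t / T by rewrite divr_ge0// ltW.
  have s2 : s ^+ 2 = t / T by rewrite sqr_sqrtr.
  have /andP[Ns sN] := truncn_itv (sqrtr_ge0 (t / T)).
  have Nt : N%:R ^+ 2 * T <= t.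
    by rewrite -ler_pdivlMr// -s2 ler_pXn2r ?nnegrE ?sqrtr_ge0.
  have tN : t < N.+1%:R ^+ 2 * T.
    by rewrite -ltr_pdivrMr// -s2 ltr_pXn2r ?nnegrE ?sqrtr_ge0.
  apply: (@le_trans _ _ (term N t)); last first.
    apply: le_trans (nneseries_lim_ge N.+1 _) => //.
    rewrite big_nat_recr//=; apply: leeDr.
    by apply: sume_ge0 => i _; exact: term0.
  rewrite /term indicE mem_set; last by rewrite /I/= in_itv/= Nt tN.
  rewrite mulr1 /decay; case: eqVneq => [_|N0].
    apply: probability_le1; apply: measurable_RV_preimage.
    exact: measurable_eball.
  have N1 : (0 < N)%N by rewrite lt0n.
  apply: (le_trans (probability_ball_le d3 X_unimodal X_psi eta0 p0 N1 Nt t0)).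
  rewrite lee_fin ler_wpM2l ?mulr_ge0 ?exprn_ge0//.
  rewrite lef_pV2 ?posrE ?exprn_gt0 ?ltr0n//.
  by rewrite ler_weXn2l// ler1n.
rewrite integral_nneseries//.
apply: lime_le; first by apply: is_cvg_nneseries => N _ _; exact: integral_ge0.
apply: nearW => n.
have termE N : (\int[leb]_t term N t = (decay N * (2 * N%:R + 1) * T)%:E)%E.
  rewrite /term; under eq_integral do rewrite EFinM.
  have mI : measurable (I N) by exact: measurable_itv.
  have m1I : measurable_fun setT (fun t : R => (\1_(I N) t)%:E : \bar R).
    by apply/measurable_EFinP; exact: measurable_indic.
  have c0 : (0 <= (decay N)%:E)%E by rewrite lee_fin decay_ge0.
  rewrite ge0_integralZl//.
  rewrite integral_indic//.
  rewrite setIT /I /= lebesgue_measure_itv/= lte_fin ltr_pM2r// ltr_pXn2r ?nnegrE//.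
  rewrite ltr_nat ltnSn -EFinB -EFinM; congr EFin.
  by rewrite -natr1; ring.
rewrite (eq_bigr (fun N => (decay N * (2 * N%:R + 1) * T)%:E)); last by move=> N _; exact: termE.
rewrite sumEFin lee_fin -mulr_suml ler_wpM2r ?(ltW T0)//.
exact: sum_decay_le.
Qed.

End potential_upper_bound_integral.

(** * Capacity of balls *)

Section capacity.
Context {R : realType} {d : nat} {disp : measure_display}.
Context {Omega : measurableType disp} {P : probability Omega R}.
Variable X : R -> {RV P >-> 'rV[R]_d}.
Hypothesis d0 : (0 < d)%N.
Hypothesis X_levy : levy_process X.

Local Notation leb := (@lebesgue_measure R).
Local Notation eball := (@closed_eball R d).

Lemma le_potential (A B : set 'rV[R]_d) : A `<=` B ->
  (potential X A <= potential X B)%E.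
Proof.
move=> AB; apply: le_integral_patch => [w _|w _|w].
- by apply: integral_ge0 => t _; rewrite lee_fin.
- by apply: integral_ge0 => t _; rewrite lee_fin.
rewrite !patch_setT; apply: le_integral_patch => [t _|t _|t].
- by rewrite lee_fin.
- by rewrite lee_fin.
rewrite !patchE; case: ifPn => // _; rewrite lee_fin !indicE.
case: (boolP (_ \in A)) => [/set_mem At|_]; last exact: ler0n.
by rewrite mem_set//; exact: AB.
Qed.

Lemma potential_ge0 (A : set 'rV[R]_d) : (0 <= potential X A)%E.
Proof.
by apply: integral_ge0 => w _; apply: integral_ge0 => t _; rewrite lee_fin.
Qed.

Lemma hitting_prob_ge0 A x : (0 <= hitting_prob X A x)%E.
Proof. exact: mu_ext_ge0. Qed.

Lemma hitting_prob_le1 A x : (hitting_prob X A x <= 1)%E.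
Proof.
rewrite -(probability_setT P) -(measurable_mu_extE P measurableT).
exact: le_mu_ext.
Qed.

(** By right-continuity the process started in the interior of the ball stays
    there for a while. *)
Lemma hitting_prob_cube r x : 0 < r -> cube (r / (2 * d%:R)) x ->
  (1 <= hitting_prob X (eball r) x)%E.
Proof.
move=> r0 xr; set l := r / _ in xr.
have D0 : 0 < d%:R :> R by rewrite ltr0n.
have l0 : 0 < l by rewrite divr_gt0// mulr_gt0.
have [N [mN PN subN]] : {ae P, forall w, X 0 w = 0 /\ cadlag (X ^~ w)}.
  by apply: filterI; [exact: (levy_start X_levy)|exact: (levy_cadlag X_levy)].
have mNC : measurable (~` N) by exact: measurableC.
have <- : P (~` N) = 1%E by rewrite probability_setC// PN sube0.
rewrite -(measurable_mu_extE P mNC); apply: le_mu_ext => w Nw.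
have [X0 [rc _]] : X 0 w = 0 /\ cadlag (X ^~ w).
  by apply: contrapT => H; apply: Nw; exact: subN.
have /= {}rc := rc 0 (lexx 0); rewrite X0 in rc.
have near_small : \forall t \near 0^'+, forall i, `|X t w ord0 i| <= l.
  apply: filter_forall => i.
  have ci : X t w ord0 i @[t --> 0^'+] --> (0 : 'rV[R]_d) ord0 i.
    apply: (@cvg_comp _ _ _ (X ^~ w) (fun x : 'rV[R]_d => x ord0 i)); last exact: coord_continuous.
    exact: rc.
  by rewrite mxE in ci; move/cvgr0Pnorm_le : ci; apply.
have [t [t0 tl]] : exists t, 0 < t /\ forall i, `|X t w ord0 i| <= l.
  near (0 : R)^'+ => t.
  exists t; split; first by near: t; exact: nbhs_right_gt.
  by near: t.
apply: (@le_lt_trans _ _ t%:E); last exact: ltry.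
apply: ereal_inf_lbound; exists t => //; split => //.
have rE : r = d%:R * (2 * l) by rewrite /l; field; rewrite gt_eqF.
rewrite /closed_eball/= rE; apply: enorm_le_dim => i; rewrite mxE.
rewrite (le_trans (ler_normD _ _))// (_ : 2 * l = l + l); last by ring.
exact: lerD.
Unshelve. all: by end_near. Qed.

Variables (r : R) (rho : {measure set 'rV[R]_d -> \bar R}).
Hypothesis rhoP : equilibrium_measure X (eball r) rho.

(** The equilibrium identity is evaluated on the ball of radius [2 * s]: its
    translates by points of the ball of radius [r] contain the ball of radius
    [s], and hitting probabilities are at most one. *)
Lemma capacity_le s : r <= s -> 0 < s ->
  (potential X (eball s) * rho (eball r) <= ((4 * s) ^+ d)%:E)%E.
Proof.
move=> rs s0; have [_ /(_ (eball (2 * s)) (measurable_eball _)) E] := rhoP.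
apply: (@le_trans _ _ (\int[lebesgue_rV d]_(x in cube (2 * s)) 1%E)%E); last first.
  rewrite integral_cube1 ?mulr_gt0// lee_fin (_ : 2 * (2 * s) = 4 * s)//.
  by ring.
apply: (@le_trans _ _ (\int[lebesgue_rV d]_(x in eball (2 * s)) hitting_prob X (eball r) x)%E); last first.
  apply: le_integral_patch => [x _|//|x]; first exact: hitting_prob_ge0.
  rewrite !patchE; case: ifPn => [/set_mem xs|_]; last by case: ifPn.
  rewrite ifT; first exact: hitting_prob_le1.
  by apply/mem_set; exact: eball_sub_cube.
rewrite -E -integral_cst; last exact: measurable_eball.
apply: le_integral_patch => [x _|x _|x].
- exact: potential_ge0.
- exact: potential_ge0.
rewrite patch_setT patchE; case: ifPn => [/set_mem xr|_]; last exact: potential_ge0.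
apply: le_potential => z zs; exists (z + x); last by rewrite addrK.
by apply: enormD_le => //; exact: le_trans xr rs.
Qed.

(** The equilibrium identity is evaluated on the ball itself: its translates by
    its own points lie in the ball of radius [2 * r], and the hitting probability
    is one in the interior. *)
Lemma capacity_ge : 0 < r ->
  (((r / d%:R) ^+ d)%:E <= potential X (eball (2 * r)) * rho (eball r))%E.
Proof.
move=> r0; have [rhoC /(_ (eball r) (measurable_eball _)) E] := rhoP.
have D0 : 0 < d%:R :> R by rewrite ltr0n.
pose l := r / (2 * d%:R).
have l0 : 0 < l by rewrite divr_gt0// mulr_gt0.
apply: (@le_trans _ _ (\int[lebesgue_rV d]_(x in cube l) 1%E)%E).
  rewrite integral_cube1// lee_fin (_ : 2 * l = r / d%:R)// /l.
  by field; rewrite gt_eqF.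
apply: (@le_trans _ _ (\int[lebesgue_rV d]_(x in eball r) hitting_prob X (eball r) x)%E).
  apply: le_integral_patch => [//|x _|x]; first exact: hitting_prob_ge0.
  rewrite !patchE; case: ifPn => [/set_mem xl|_]; last first.
    by case: ifPn => // _; exact: hitting_prob_ge0.
  rewrite ifT; first exact: hitting_prob_cube.
  apply/mem_set; rewrite /closed_eball/=; apply: (le_trans (enorm_le_dim xl)).
  by rewrite /l [leLHS](_ : _ = r / 2); [lra|field; rewrite gt_eqF].
rewrite -E.
pose c := potential X (eball (2 * r)).
have c0 : (0 <= c)%E by exact: potential_ge0.
have mK : measurable (eball r) := measurable_eball r.
pose g (x : 'rV[R]_d) : \bar R := if x \in eball r then c else +oo%E.
have g0 x : (0 <= g x)%E by rewrite /g; case: ifPn.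
apply: (@le_trans _ _ (\int[rho]_x g x)%E).
  apply: le_integral_patch => [x _|x _//|x]; first exact: potential_ge0.
  rewrite !patch_setT /g; case: ifPn => [/set_mem xr|_]; last exact: leey.
  apply: le_potential => _ [y yr <-]; exact: enormB_le.
have mg : measurable_fun setT g.
  apply: measurable_fun_ifT => //.
  apply: (@measurable_fun_bool _ _ _ _ true).
  by rewrite setTI (_ : _ @^-1` _ = eball r)//; apply/seteqP; split=> w /=; [exact: set_mem|exact: mem_set].
rewrite (@ge0_ae_eq_integral _ _ _ rho setT g (cst c))//; last first.
  exists (~` eball r); split => //; first exact: measurableC.
  by move=> x /=; apply: contra_not => xr _; rewrite /g mem_set.
rewrite integral_cst// -/c; apply: lee_wpmul2l => //.
rewrite -(setvU (eball r)) measureU//.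
- by rewrite [X in (X + _ <= _)%E](_ : _ = 0%E) ?add0e//; exact: rhoC.
- exact: measurableC.
- by rewrite setICl.
Qed.

End capacity.

Section capacity_bounds.
Context {R : realType} {d : nat} {disp : measure_display}.
Context {Omega : measurableType disp} {P : probability Omega R}.
Variable X : R -> {RV P >-> 'rV[R]_d}.
Variable psi : 'rV[R]_d -> R[i].
Hypothesis d3 : (3 <= d)%N.
Hypothesis X_levy : levy_process X.
Hypothesis X_unimodal : isotropic_unimodal_process X.
Hypothesis X_psi : char_exponent X psi.
Hypothesis psi_neq0 : exists xi, psi xi <> 0.

Local Notation p := (re_exponent psi).
Local Notation K := (radial_const (R := R) (d := d)).
Local Notation Cp := (exponent_const (R := R) (d := d)).
Local Notation eball := (@closed_eball R d).

Let d0 : (0 < d)%N. Proof. exact: leq_trans d3. Qed.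

Definition first_unit_vector : 'rV[R]_d := \row_i ((i : nat) == 0)%:R.

Lemma enorm_first_unit_vector : enorm first_unit_vector = 1.
Proof.
rewrite /enorm /dotv (bigD1 (Ordinal d0))//= mxE/= mulr1 big1 ?addr0 ?sqrtr1//.
move=> i i0; rewrite mxE (_ : (i : nat) == 0 = false) ?mul0r//.
by apply/negbTE; apply: contra i0 => /eqP i0; apply/eqP/val_inj.
Qed.

Lemma enorm_scale_first_unit_vector a : 0 <= a -> enorm (a *: first_unit_vector) = a.
Proof. by move=> a0; rewrite enormZ// enorm_first_unit_vector mulr1. Qed.

Lemma scale_first_unit_vector_neq0 a : 0 < a -> a *: first_unit_vector != 0.
Proof. by move=> a0; rewrite -enorm_gt0 enorm_scale_first_unit_vector ?ltW. Qed.

(** A zero of the exponent away from the origin would make [psi] vanish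
    everywhere, by [re_exponent_le]. *)
Lemma re_exponent_gt0 eta : eta != 0 -> 0 < p eta.
Proof.
move=> eta0; rewrite lt_neqAle (re_exponent_ge0 X_unimodal X_psi) andbT.
apply/eqP => peta; have [xi] := psi_neq0; apply.
have := re_exponent_le d0 X_unimodal X_psi xi eta0; rewrite -peta mulr0.
have := re_exponent_ge0 X_unimodal X_psi xi => p1 p2.
have : p xi = 0 by apply/eqP; rewrite eq_le p1 p2.
have := im_exponent_eq0 X_unimodal X_psi xi; rewrite /re_exponent.
by case: (psi xi) => a b /= -> ->.
Qed.

Lemma psi_star_has_sup u : 0 <= u ->
  has_sup [set complex.Re (psi x) | x in eball u].
Proof.
move=> u0; split.
  by exists (complex.Re (psi 0)), 0 => //; rewrite /closed_eball/= enorm0.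
exists (Cp * Num.max 1 (u ^+ 2) * p first_unit_vector) => _ [x xu <-].
have u1 : first_unit_vector != 0 by rewrite -enorm_gt0 enorm_first_unit_vector.
apply: (le_trans (re_exponent_le d0 X_unimodal X_psi x u1)).
rewrite enorm_first_unit_vector divr1 ler_wpM2r ?(re_exponent_ge0 X_unimodal X_psi)//.
rewrite ler_wpM2l ?(ltW (exponent_const_gt0 d3))// le_max2//.
by apply: sqr_le_norm; rewrite !ger0_norm ?enorm_ge0.
Qed.

Lemma le_psi_star u : 0 <= u -> p (u *: first_unit_vector) <= psi_star psi u.
Proof.
move=> u0; apply: (sup_upper_bound (psi_star_has_sup u0)).
by exists (u *: first_unit_vector) => //; rewrite /closed_eball/= enorm_scale_first_unit_vector.
Qed.

(** The upper bound on the capacity involves the exponent at [r^-1], the lower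
    bound at [r^-1 / 2]; [re_exponent_le] reconciles them. *)
Lemma psi_star_le u : 0 < u -> psi_star psi u <= 4 * Cp * p ((u / 2) *: first_unit_vector).
Proof.
move=> u0; have u20 : 0 < u / 2 by rewrite divr_gt0.
apply: sup_le_ub; first exact: (psi_star_has_sup (ltW u0)).1.
move=> _ [x xu <-].
apply: (le_trans (re_exponent_le d0 X_unimodal X_psi x (scale_first_unit_vector_neq0 u20))).
rewrite (enorm_scale_first_unit_vector (ltW u20)).
rewrite ler_wpM2r ?(re_exponent_ge0 X_unimodal X_psi)// mulrC.
rewrite ler_wpM2r ?(ltW (exponent_const_gt0 d3))// ge_max; apply/andP; split; first by lra.
have q2 : enorm x / (u / 2) <= 2 by rewrite ler_pdivrMr// mulrC divfK.
have q0 : 0 <= enorm x / (u / 2) by rewrite divr_ge0 ?enorm_ge0 ?ltW.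
by nra.
Qed.

Lemma measure_eball_le (rho : {measure set 'rV[R]_d -> \bar R}) r s :
  equilibrium_measure X (eball r) rho -> r <= s -> 0 < s ->
  (rho (eball r) <= (4 * K * p (s^-1 *: first_unit_vector) * (4 * s) ^+ d)%:E)%E.
Proof.
move=> rhoP rs s0; have si0 : 0 < s^-1 by rewrite invr_gt0.
have K0 : 0 < K := radial_const_gt0 d0.
have eta0 := scale_first_unit_vector_neq0 si0; have p0 := re_exponent_gt0 eta0.
have := potential_ball_ge d3 X_levy X_unimodal X_psi eta0 p0.
rewrite (enorm_scale_first_unit_vector (ltW si0)) invrK => G.
have := le_trans (lee_wpmul2r (measure_ge0 rho _) G) (capacity_le rhoP rs s0).
have L0 : 0 < 4 * K * p (s^-1 *: first_unit_vector) by rewrite mulr_gt0// mulr_gt0.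
by rewrite lee_pdivrMl// -EFinM.
Qed.

Definition capacity_upper_const : R := 4 * K * 4 ^+ d.

Definition capacity_lower_const : R :=
  4 * Cp ^+ 2 * (1 + 24 * 3 ^+ d) * d%:R ^+ d * d%:R ^+ 4.

Lemma capacity_eball_le (rho : {measure set 'rV[R]_d -> \bar R}) r :
  equilibrium_measure X (eball r) rho -> 0 < r ->
  (rho (eball r) <= (capacity_upper_const * (psi_star psi r^-1 * r ^+ d))%:E)%E.
Proof.
move=> rhoP r0; apply: (le_trans (measure_eball_le rhoP (lexx r) r0)).
have K0 : 0 < K := radial_const_gt0 d0.
have ri0 : 0 <= r^-1 by rewrite invr_ge0 ltW.
rewrite lee_fin /capacity_upper_const exprMn.
rewrite [leRHS](_ : _ = 4 * K * psi_star psi r^-1 * (4 ^+ d * r ^+ d)); last by ring.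
rewrite ler_wpM2r ?mulr_ge0 ?exprn_ge0 ?(ltW r0)//.
by rewrite ler_wpM2l ?mulr_ge0 ?(ltW K0)// le_psi_star.
Qed.

(** In dimension at least three the capacity of a small ball is at most of the
    order of its radius, since [psi] grows at most quadratically. *)
Lemma capacity_origin (rho : {measure set 'rV[R]_d -> \bar R}) :
  equilibrium_measure X (eball 0) rho -> rho (eball 0) = 0%E.
Proof.
move=> rhoP; apply/eqP; rewrite eq_le measure_ge0 andbT.
have K0 : 0 < K := radial_const_gt0 d0.
have Cp0 : 0 < Cp := exponent_const_gt0 d3.
have u0 : first_unit_vector != 0 by rewrite -enorm_gt0 enorm_first_unit_vector.
have p0 := re_exponent_gt0 u0.
pose c := 4 * K * (Cp * p first_unit_vector) * 4 ^+ d.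
have c0 : 0 < c.
  by rewrite /c mulr_gt0 ?exprn_gt0// mulr_gt0// mulr_gt0.
apply/lee_addgt0Pr => e e0; rewrite add0e.
pose s := Num.min 1 (e / c).
have s0 : 0 < s by rewrite lt_min ltr01 divr_gt0.
have s1 : s <= 1 by rewrite ge_min lexx.
apply: (le_trans (measure_eball_le rhoP (ltW s0) s0)); rewrite lee_fin.
have si1 : 1 <= s^-1 by rewrite invf_ge1.
have := re_exponent_le d0 X_unimodal X_psi (s^-1 *: first_unit_vector) u0.
rewrite enorm_first_unit_vector divr1 enorm_scale_first_unit_vector ?(le_trans ler01)//.
rewrite (max_idPr _) ?exprn_ege1// => H.
have sd : s ^+ d <= s ^+ 3 by apply: ler_wiXn2l => //; exact: ltW.
apply: (@le_trans _ _ (c * s)).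
  rewrite exprMn /c.
  apply: (@le_trans _ _ (4 * K * (Cp * s^-1 ^+ 2 * p first_unit_vector) * (4 ^+ d * s ^+ 3))).
    apply: ler_pM.
    - by rewrite !mulr_ge0 ?(ltW K0)// (re_exponent_ge0 X_unimodal X_psi).
    - by rewrite mulr_ge0 ?exprn_ge0 ?(ltW s0).
    - by rewrite ler_wpM2l ?mulr_ge0 ?(ltW K0).
    - by rewrite ler_wpM2l ?exprn_ge0.
  by rewrite le_eqVlt; apply/orP; left; apply/eqP; field; rewrite gt_eqF.
by rewrite mulrC -ler_pdivlMr// /s ge_min lexx orbT.
Qed.

Lemma capacity_eball_ge (rho : {measure set 'rV[R]_d -> \bar R}) r :
  equilibrium_measure X (eball r) rho -> 0 < r ->
  ((psi_star psi r^-1 * r ^+ d)%:E <= capacity_lower_const%:E * rho (eball r))%E.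
Proof.
move=> rhoP r0; have ri0 : 0 < r^-1 by rewrite invr_gt0.
have Cp0 : 0 < Cp := exponent_const_gt0 d3.
have D0 : 0 < d%:R :> R by rewrite ltr0n.
have h0 : 0 < r^-1 / 2 by rewrite divr_gt0.
have eta0 := scale_first_unit_vector_neq0 h0; have p0 := re_exponent_gt0 eta0.
have := potential_ball_le d3 X_levy X_unimodal X_psi eta0 p0.
rewrite (enorm_scale_first_unit_vector (ltW h0)) (_ : (r^-1 / 2)^-1 = 2 * r); last first.
  by rewrite invfM !invrK mulrC.
set T := _ * time_scale psi _ => GT.
have := le_trans (capacity_ge d0 X_levy rhoP r0) (lee_wpmul2r (measure_ge0 rho _) GT).
set q := p ((r^-1 / 2) *: first_unit_vector) in p0.
have T0 : 0 < T.
  rewrite /T /time_scale; apply: mulr_gt0; last first.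
    by rewrite divr_gt0// mulr_gt0// exprn_gt0.
  by apply: ltr_wpDr; rewrite ?mulr_ge0 ?exprn_ge0.
pose L := 4 * Cp * q * d%:R ^+ d.
have L0 : 0 < L by rewrite /L mulr_gt0 ?exprn_gt0// mulr_gt0// mulr_gt0.
move=> /(lee_wpmul2l (_ : 0 <= L%:E)%E); rewrite lee_fin => /(_ (ltW L0)).
rewrite muleA -!EFinM (_ : L * T = capacity_lower_const); last first.
  rewrite /L /T /time_scale /capacity_lower_const -/q.
  by field; rewrite gt_eqF.
apply: le_trans; rewrite lee_fin /L exprMn.
rewrite [leRHS](_ : _ = 4 * Cp * q * r ^+ d); last first.
  by rewrite exprVn; field; rewrite expf_neq0// gt_eqF.
by rewrite ler_wpM2r ?exprn_ge0 ?(ltW r0)// psi_star_le.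
Qed.

End capacity_bounds.

Theorem proposition3 (R : realType) (d : nat) (hd : (3 <= d)%N) :
  exists2 C : R, 0 < C &
  forall (disp : measure_display) (Omega : measurableType disp)
    (P : probability Omega R) (X : R -> {RV P >-> 'rV[R]_d})
    (psi : 'rV[R]_d -> R[i]),
    levy_process X -> isotropic_unimodal_process X -> char_exponent X psi ->
    (exists xi, psi xi <> 0) ->
    forall r : R, 0 <= r ->
    forall cap : \bar R, is_capacity X (closed_eball r) cap ->
    ((C^-1 * (psi_star psi r^-1 * r ^+ d))%:E <= cap)%E /\
    (cap <= (C * (psi_star psi r^-1 * r ^+ d))%:E)%E.
Proof.
have d0 : (0 < d)%N by exact: leq_trans hd.
have D0 : 0 < d%:R :> R by rewrite ltr0n.
pose A := @capacity_upper_const R d; pose B := @capacity_lower_const R d.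
have A0 : 0 < A.
  rewrite /A /capacity_upper_const mulr_gt0 ?exprn_gt0// mulr_gt0//.
  exact: radial_const_gt0.
have B0 : 0 < B.
  have Cp0 : 0 < exponent_const (R := R) (d := d) by exact: exponent_const_gt0.
  rewrite /B /capacity_lower_const mulr_gt0 ?exprn_gt0//.
  rewrite mulr_gt0 ?exprn_gt0//; apply: mulr_gt0.
    by rewrite mulr_gt0 ?exprn_gt0.
  by apply: ltr_wpDr; rewrite ?mulr_ge0 ?exprn_ge0.
exists (A + B); first exact: addr_gt0.
move=> disp Omega P X psi Xl Xu Xpsi psi0 r r0 _ [rho rhoP ->].
move: r0; rewrite le_eqVlt => /predU1P[r0|r0].
  rewrite -r0 in rhoP *.
  rewrite (capacity_origin hd Xl Xu Xpsi psi0 rhoP).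
  by rewrite expr0n/= (gtn_eqF d0) !mulr0 lexx.
have S0 : 0 <= psi_star psi r^-1 * r ^+ d.
  rewrite mulr_ge0 ?exprn_ge0 ?(ltW r0)//.
  have ri0 : 0 <= r^-1 by rewrite invr_ge0 ltW.
  exact: le_trans (re_exponent_ge0 Xu Xpsi _) (le_psi_star hd Xu Xpsi ri0).
split.
  have := capacity_eball_ge hd Xl Xu Xpsi psi0 rhoP r0.
  rewrite -lee_pdivrMl// -EFinM; apply: le_trans.
  rewrite lee_fin ler_wpM2r// lef_pV2 ?posrE ?addr_gt0//.
  by rewrite lerDr ltW.
apply: (le_trans (capacity_eball_le hd Xl Xu Xpsi psi0 rhoP r0)).
by rewrite lee_fin ler_wpM2r// lerDl ltW.
Qed.
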